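(* Let $k\ge 3$, $1\le s\le k$, $n_1,\dots,n_k$ and $r\le\min\{n_1,\dots,n_s\}$ be positive integers, let $\mathcal A\in\mathbb R^{n_1}\otimes\cdots\otimes\mathbb R^{n_k}$ be a nonzero tensor, and let $\{U_{[p]}\}_{p\ge 0}$ be any sequence generated by the iAPD-ALS algorithm (described in the context) with input $\mathcal A$, $r$, a proximal parameter $\epsilon>0$ and truncation parameter $\kappa$. Then the sequence $\{U_{[p]}\}$ is bounded and converges to a point $U^*$ which is a KKT point of problem $\mathrm{mLRPOTA}(t)$, where $t$ is the eventual (constant) number of columns of the iterates; equivalently, $(U^*,\operatorname{diag}_k(\lambda_1(U^* ),\dots,\lambda_t(U^* )))$ is a KKT point of the corresponding low rank partially orthogonal approximation problem.
   Context: Notation. $\mathrm V(m,n)=\{U\in\mathbb R^{n\times m}:U^{\mathsf T}U=I_m\}$; $\mathrm B(m,n)$ is the set of $n\times m$ real matrices all of whose columns have Euclidean norm $1$. For $\mathcal A\in\mathbb R^{n_1}\otimes\cdots\otimes\mathbb R^{n_k}$ and $\mathbf u_i\in\mathbb R^{n_i}$ let $\mathcal A\tau(\mathbf u_1,\dots,\mathbf u_k)=\langle\mathcal A,\mathbf u_1\otimes\cdots\otimes\mathbf u_k\rangle$ and let $\mathcal A\tau_i(\mathbf u_1,\dots,\mathbf u_k)\in\mathbb R^{n_i}$ be the vector obtained by contracting $\mathcal A$ with $\mathbf u_l$ for all $l\neq i$ (so $\langle\mathcal A\tau_i(\mathbf u_1,\dots,\mathbf u_k),\mathbf u_i\rangle=\mathcal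 A\tau(\mathbf u_1,\dots,\mathbf u_k)$). For a tuple $U=(U^{(1)},\dots,U^{(k)})$ of matrices $U^{(i)}\in\mathbb R^{n_i\times t}$ with columns $\mathbf u^{(i)}_j$, put $\lambda_j(U)=\mathcal A\tau(\mathbf u^{(1)}_j,\dots,\mathbf u^{(k)}_j)$ and $f(U)=\sum_{j=1}^t\lambda_j(U)^2$. $\operatorname{diag}_k(\lambda)$ is the diagonal tensor in $(\mathbb R^t)^{\otimes k}$ with diagonal $\lambda$, and $\operatorname{diag}_2$ the diagonal matrix. For $X\in\mathbb R^{n\times m}$, $n\ge m$, $\operatorname{Polar}(X)$ is the set of $Q\in\mathrm V(m,n)$ maximizing $\langle Q,X\rangle$ over $\mathrm V(m,n)$ (the orthonormal polar factors of $X$). Problem $\mathrm{mLRPOTA}(t)$: maximize $f(U)$ over $U\in\mathrm V(t,n_1)\times\cdots\times\mathrm V(t,n_s)\times\mathrm B(t,n_{s+1})\times\cdots\times\mathrm B(t,n_k)$. A feasible $U$ is a KKT point of it iff there exist symmetric $P_1,\dots,P_s\in\mathbb R^{t\times t}$ and $\mathbf p\in\mathbb R^t$ with $V^{(i)}\Lambda=U^{(i)}P_i$ for $i\le s$ and $V^{(i)}\Lambda=U^{(i)}\operatorname{diag}_2(\mathbf p)$ for $i>s$, where $V^{(i)}$ has columns $\mathcal A\tau_i(\mathbf u^{(1)}_j,\dots,\mathbf u^{(k)}_j)$ and $\Lambda=\operatorname{diag}_2(\lambda_1(U),\dots,\lambda_t(U))$ (this is the Lagrange/KKT condition of the problem).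 iAPD-ALS algorithm. Input: nonzero $\mathcal A$, $r$, $\epsilon>0$. Choose $U_{[0]}\in\mathrm V(r,n_1)\times\cdots\times\mathrm V(r,n_s)\times\mathrm B(r,n_{s+1})\times\cdots\times\mathrm B(r,n_k)$ with $f(U_{[0]})>0$ and $\kappa\in(0,\sqrt{f(U_{[0]})/r})$. For $p=1,2,\dots$, with $t$ the current number of columns and $\mathbf u^{(i)}_{j,[q]}$ the $j$-th column of $U^{(i)}_{[q]}$, set $\mathbf x^i_{j,[p]}=(\mathbf u^{(1)}_{j,[p]},\dots,\mathbf u^{(i-1)}_{j,[p]},\mathbf u^{(i)}_{j,[p-1]},\dots,\mathbf u^{(k)}_{j,[p-1]})$, $\lambda^{i-1}_{j,[p]}=\mathcal A\tau(\mathbf x^i_{j,[p]})$, $\Lambda^{(i)}_{[p]}=\operatorname{diag}_2(\lambda^{i-1}_{1,[p]},\dots,\lambda^{i-1}_{t,[p]})$, $V^{(i)}_{[p]}=[\mathcal A\tau_i(\mathbf x^i_{1,[p]}),\dots,\mathcal A\tau_i(\mathbf x^i_{t,[p]})]$ (computed once the needed columns exist), and perform: (1) for $i=1,\dots,s$ in turn, pick $U^{(i)}_{[p]}\in\operatorname{Polar}(V^{(i)}_{[p]}\Lambda^{(i)}_{[p]})$ and $S^{(i)}_{[p]}=(U^{(i)}_{[p]})^{\mathsf T}V^{(i)}_{[p]}\Lambda^{(i)}_{[p]}$; if the smallest eigenvalue of $S^{(i)}_{[p]}$ is $<\epsilon$ (proximal correction), instead pick $U^{(i)}_{[p]}\in\operatorname{Polar}(V^{(i)}_{[p]}\Lambda^{(i)}_{[p]}+\epsilon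 U^{(i)}_{[p-1]})$; (2) truncation: let $J$ be the set of $j$ with $|((U^{(s)}_{[p]})^{\mathsf T}V^{(s)}_{[p]})_{jj}|<\kappa$; if $J\ne\emptyset$, delete the columns indexed by $J$ from $U^{(1)}_{[p]},\dots,U^{(s)}_{[p]}$ and from $U^{(s+1)}_{[p-1]},\dots,U^{(k)}_{[p-1]}$ and replace $t$ by $t-|J|$ (such an iteration is a truncation iteration); (3) for $i=s+1,\dots,k$ in turn and each $j$, set $\mathbf u^{(i)}_{j,[p]}=\operatorname{sgn}(\lambda^{i-1}_{j,[p]})\,\mathcal A\tau_i(\mathbf x^i_{j,[p]})/\|\mathcal A\tau_i(\mathbf x^i_{j,[p]})\|$. Set $U_{[p]}=(U^{(1)}_{[p]},\dots,U^{(k)}_{[p]})$. The algorithm is iterated indefinitely (choices within $\operatorname{Polar}$ are arbitrary). The number of columns is non-increasing, hence eventually constant. *)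

(* Defs.v *)
From HB Require Import structures.
From mathcomp Require Import all_boot all_order all_algebra.
From mathcomp Require Import all_classical all_reals topology normedtype sequences.
Unset Printing Implicit Defensive.
Import Order.TTheory GRing.Theory Num.Theory.
Local Open Scope ring_scope.

Section IAPD.
Context {R : realType} {k : nat} (n : 'I_k -> nat).

(* multi-indices of R^{n_1} (x) ... (x) R^{n_k}; modes are 0-indexed *)
Definition mindex := {dffun forall l : 'I_k, 'I_(n l)}.
Definition tensor := mindex -> R.
Definition vfam := forall l : 'I_k, 'I_(n l) -> R.

Definition tau (A : tensor) (x : vfam) : R :=
  \sum_(idx : mindex) A idx * \prod_(l : 'I_k) x l (idx l).
Definition tau_i (A : tensor) (i : 'I_k) (x : vfam) : 'I_(n i) -> R :=
  fun a => \sum_(idx : mindex | idx i == a) A idx *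
           \prod_(l : 'I_k | l != i) x l (idx l).

Definition dot {m : nat} (u v : 'I_m -> R) : R := \sum_(a < m) u a * v a.
Definition vnorm {m : nat} (u : 'I_m -> R) : R := Num.sqrt (dot u u).

(* an n x t matrix represented by its columns (column j = cols j, j < t;
   columns with index >= t are irrelevant) *)
Definition cols (m : nat) := nat -> 'I_m -> R.
Definition iterate := forall l : 'I_k, cols (n l).
(* state of the algorithm: (current number of columns t, U) *)
Definition state := (nat * iterate)%type.

Definition orthonormal {m : nat} (t : nat) (Q : cols m) : Prop :=
  forall j j', (j < t)%N -> (j' < t)%N -> dot (Q j) (Q j') = (j == j')%:R.
Definition unitcols {m : nat} (t : nat) (Q : cols m) : Prop :=
  forall j, (j < t)%N -> dot (Q j) (Q j) = 1.

Definition feasible (s t : nat) (U : iterate) : Prop :=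
  forall l : 'I_k, ((l < s)%N -> orthonormal t (U l)) /\
                   ((s <= l)%N -> unitcols t (U l)).

Definition colsof (U : iterate) (j : nat) : vfam := fun l => U l j.
Definition lam (A : tensor) (U : iterate) (j : nat) : R := tau A (colsof U j).
Definition fobj (A : tensor) (t : nat) (U : iterate) : R :=
  \sum_(j < t) lam A U j ^+ 2.

Definition inner {m : nat} (t : nat) (Q X : cols m) : R := \sum_(j < t) dot (Q j) (X j).
Definition polar {m : nat} (t : nat) (X Q : cols m) : Prop :=
  orthonormal t Q /\ forall Q', orthonormal t Q' -> inner t Q' X <= inner t Q X.

Definition Smat {m : nat} (t : nat) (Q X : cols m) : 'M[R]_t :=
  \matrix_(j < t, l < t) dot (Q j) (X l).
Definition min_eig_lt {t : nat} (S : 'M[R]_t) (eps : R) : Prop :=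
  exists2 a, eigenvalue S a & a < eps.

Definition mix (i : 'I_k) (Unew Uold : iterate) (j : nat) : vfam :=
  fun l => if (l < i)%N then Unew l j else Uold l j.

Definition iapd_step (A : tensor) (s : nat) (eps kappa : R) (st st' : state)
  : Prop :=
  let t := st.1 in let U0 := st.2 in
  exists U1 : iterate,
    let Vc := fun (i : 'I_k) (j : nat) => tau_i A i (mix i U1 U0 j) in
    let lm := fun (i : 'I_k) (j : nat) => tau A (mix i U1 U0 j) in
    let X := fun (i : 'I_k) => (fun j a => Vc i j a * lm i j) : cols (n i) in
    (forall i : 'I_k, (i < s)%N ->
       exists2 Q0, polar t (X i) Q0 &
         ((~ min_eig_lt (Smat t Q0 (X i)) eps /\
             forall j, (j < t)%N -> U1 i j = Q0 j)
          \/ (min_eig_lt (Smat t Q0 (X i)) eps /\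
             polar t (fun j a => X i j a + eps * U0 i j a) (U1 i)))) /\
    (* stage (2): truncation; keep the j with |((U^(s))^T V^(s))_jj| >= kappa *)
    let keep := [seq j <- iota 0 t |
                  [forall i : 'I_k, (i.+1 == s) ==>
                      (kappa <= `|dot (U1 i j) (Vc i j)|)]] in
    let t' := size keep in
    let U1t := (fun i j => U1 i (nth 0%N keep j)) : iterate in
    let U0t := (fun i j => U0 i (nth 0%N keep j)) : iterate in
    st'.1 = t' /\
    forall i : 'I_k, forall j, (j < t')%N ->
      ((i < s)%N -> st'.2 i j = U1t i j) /\
      ((s <= i)%N ->
         let x := mix i st'.2 U0t j in
         let w := tau_i A i x in
         st'.2 i j = fun a => Num.sg (tau A x) / vnorm w * w a).

Definition KKT (A : tensor) (s t : nat) (U : iterate) : Prop :=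
  feasible s t U /\
  exists (P : 'I_k -> 'M[R]_t) (pv : 'I_t -> R),
    forall i : 'I_k,
      ((i < s)%N -> (P i)^T = P i /\
         forall (j : 'I_t) (a : 'I_(n i)),
           tau_i A i (colsof U j) a * lam A U j =
           \sum_(m < t) U i m a * P i m j) /\
      ((s <= i)%N ->
         forall (j : 'I_t) (a : 'I_(n i)),
           tau_i A i (colsof U j) a * lam A U j = U i j a * pv j).

End IAPD.

(* Main.v *)
(** Each block update increases the objective f by at least a multiple of the
    squared displacement, and the violation G of the stationarity equations
    after a sweep is bounded by the squared displacement of that sweep.  Finite
    length of the trajectory then follows from a Kurdyka-Lojasiewicz inequality
    for polynomials on a compact real algebraic set, obtained as follows.  By
    quantifier elimination a first-order property of one real variable t and a
    parameter c changes truth value in t at most D times, uniformly in c.  Hence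
    the lexicographically least minimizer X(t) of G on the level {F* - f = t} has
    coordinates crossing every value c at most D times, so X has bounded
    variation, and its variation function is the desingularizing function: no
    differentiability of X, nor even its continuity, is needed.  The number of
    columns is nonincreasing, hence eventually constant, and from then on no
    truncation takes place. *)

From HB Require Import structures.
From mathcomp Require Import all_boot all_order all_algebra.
From mathcomp Require Import all_classical all_reals topology normedtype sequences.
From mathcomp Require Import derive polyrcf zify ring lra.
From mathcomp Require ordered_qelim qe_rcf.
Require Import Defs.
Import Order.TTheory GRing.Theory Num.Theory numFieldNormedType.Exports.
Local Open Scope classical_set_scope.
Local Open Scope ring_scope.

Set Implicit Arguments.
Unset Strict Implicit.
Unset Printing Implicit Defensive.

(** * Definable relations *)

(** The Lojasiewicz argument rests on a slope inequality between any two feasible points: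
    [|f x - f y| <= (sqrt (G x) + C d) d], where [d] is their distance. It holds because the
    constraints are quadratic: a symmetric (or diagonal) multiplier contributes only second-order
    terms to the change of [f]. Along a selection [X] of points on the levels it bounds a small rise
    of the level by the displacement of [X], even across a jump of [X], and summing over a fine
    partition compares levels with the variation of [X]. The obstacle is that the inequality is
    wanted at every [x], while the sum runs over all levels between [u] and [f x], and the least
    value of [G] on a level need not grow with the level. Near level 0, definability leaves two
    cases: either it does grow, or [G] is bounded away from 0. The inequality stays integrated, with
    increments of the variation function in place of a derivative; these increments telescope along
    the iterates. The ascent rates come from the safeguards of the algorithm: the eigenvalue test
    with its proximal correction gives [eps], the truncation gives [kappa ^+ 2]. *)

Module Ord := ordered_qelim.ord.

Fixpoint changes (A : Type) (T : eqType) (b : A -> T) (x : A) (s : seq A) : nat :=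
  if s is y :: s' then ((b x != b y) + changes b y s')%N else 0%N.

Lemma changes_le_binop (A : Type) (T : eqType) (op : T -> T -> T) (b1 b2 : A -> T) x s :
  (changes (fun a => op (b1 a) (b2 a)) x s <= changes b1 x s + changes b2 x s)%N.
Proof.
elim: s x => //= y s IH x; have := IH y.
have : ((op (b1 x) (b2 x) != op (b1 y) (b2 y)) <= (b1 x != b1 y) + (b2 x != b2 y))%N.
  case: (b1 x =P b1 y) => [->|_] /=; last by case: (_ != _).
  by case: (b2 x =P b2 y) => [->|_] /=; rewrite ?eqxx //; case: (_ != _).
lia.
Qed.

Lemma changes_comp (A : Type) (T T' : eqType) (g : T -> T') (b : A -> T) x s :
  (changes (g \o b) x s <= changes b x s)%N.
Proof.
elim: s x => //= y s IH x; apply: leq_add (IH y).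
by case: (b x =P b y) => [->|] //=; rewrite ?eqxx //; case: (_ != _).
Qed.

Lemma eq_changes (A : Type) (T : eqType) (b1 b2 : A -> T) x s :
  b1 =1 b2 -> changes b1 x s = changes b2 x s.
Proof. by move=> E; elim: s x => //= y s IH x; rewrite IH !E. Qed.

Lemma eq_in_changes (A T : eqType) (b1 b2 : A -> T) x s :
  {in x :: s, b1 =1 b2} -> changes b1 x s = changes b2 x s.
Proof.
elim: s x => //= y s IH x E; rewrite IH ?E ?inE ?eqxx ?orbT // => z zs.
by rewrite E // inE zs orbT.
Qed.

(** * Sign changes of a polynomial along an increasing chain *)

Section ChangesPoly.
Variable R : rcfType.
Implicit Types (p : {poly R}) (x y : R).

Lemma poly_sign_change_root p x y : x < y -> Num.sg p.[x] != Num.sg p.[y] ->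
  exists2 z, x <= z <= y & root p z.
Proof.
move=> xy nsg.
case: (boolP (root p x)) => [px|]; first by exists x; rewrite ?lexx ?ltW.
case: (boolP (root p y)) => [py|]; first by exists y; rewrite ?lexx ?ltW.
rewrite /root => py px.
have lexy := ltW xy.
case: (ltrgt0P p.[x]) px nsg => // hx _; case: (ltrgt0P p.[y]) py => // hy _.
- by rewrite (gtr0_sg hx) (gtr0_sg hy) eqxx.
- move=> _; have [|z zi rz] := @poly_ivtoo _ (- p) x y lexy.
    by rewrite !hornerN mulrNN pmulr_rlt0.
  by exists z; [case/andP: zi => /ltW -> /ltW ->|rewrite rootN in rz].
- move=> _; have [|z zi rz] := @poly_ivtoo _ p x y lexy.
    by rewrite nmulr_rlt0.
  by exists z => //; case/andP: zi => /ltW -> /ltW ->.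
- by rewrite (ltr0_sg hx) (ltr0_sg hy) eqxx.
Qed.

(** A root can cause two changes, one on arriving at it and one on leaving it; hence the
    doubling. *)
Lemma changes_sg_poly p x s : path <%R x s ->
  (changes (fun t => Num.sg p.[t]) x s <= (size p).*2)%N.
Proof.
have [->|p0] := eqVneq p 0.
  move=> _; rewrite (@eq_changes _ _ _ (fun=> 0)); last first.
    by move=> t; rewrite horner0 sgr0.
  by elim: s x => //= y s IH x; rewrite eqxx add0n IH.
pose r := rootsR p.
have rP z : root p z = (z \in r) by have := roots_on_rootsR p0 z; rewrite inE /=.
have ur : uniq r by exact: uniq_roots.
have sr : (size r < size p)%N.
  apply: max_poly_roots => //; apply/allP => z; by rewrite -rP.
(* Strengthened for the induction: a root at the starting point can only be left, so it counts once,
   whereas a later root counts twice. *)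
suff H : path <%R x s -> (changes (fun t => Num.sg p.[t]) x s <=
     (count (fun z => (x < z)%R) r).*2 + count_mem x r)%N.
  move=> /H.
  suff : (count (fun z => (x < z)%R) r + count_mem x r <= size r)%N by lia.
  elim: r {ur rP sr H} => //= z r; case: (ltrgtP x z) => //=; lia.
elim: s x => //= y s IH x /andP[xy /IH {}IH].
have cnt : (count (fun z => (y < z)%R) r + count_mem y r + count (fun z => (x < z < y)%R) r
             <= count (fun z => (x < z)%R) r)%N.
  elim: r {ur rP sr IH} => //= z r; case: (ltrgtP z y) => [zy|yz|->] /=.
  - by rewrite andbT; lia.
  - by rewrite (lt_trans xy yz) andbF; lia.
  - by rewrite xy; lia.
case: (boolP (_ == _)) => [_|nsg] /=.
  have aux (a1 a2 a3 a4 a5 a6 : nat) : (a1 + a2 + a3 <= a4 -> a5 <= a1.*2 + a2 ->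
    0 + a5 <= a4.*2 + a6)%N by lia.
  exact: aux cnt IH.
have [z /andP[xz zy]] := poly_sign_change_root xy nsg.
rewrite rP => zr.
have pos : (0 < count_mem x r + count (fun z => (x < z < y)%R) r + count_mem y r)%N.
  move: xz zy; rewrite !le_eqVlt => /predU1P[->|xz].
    by move=> _; rewrite -has_pred1 has_count in zr; rewrite !addn_gt0 zr.
  case/predU1P => [<-|zy]; first by rewrite -has_pred1 has_count in zr; rewrite !addn_gt0 zr orbT.
  have : has (fun z => x < z < y) r by apply/hasP; exists z; rewrite ?xz.
  by rewrite has_count => h; rewrite !addn_gt0 h orbT.
have le1 : (count_mem y r <= 1)%N by rewrite (count_uniq_mem y ur); case: (_ \in _).
have aux (a1 a2 a3 a4 a5 a6 : nat) : (a1 + a2 + a3 <= a4 -> a5 <= a1.*2 + a2 ->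
  0 < a6 + a3 + a2 -> a2 <= 1 -> 1 + a5 <= a4.*2 + a6)%N by lia.
exact: aux cnt IH pos le1.
Qed.
End ChangesPoly.

Section Definable.
Variable R : rcfType.

(** An atom is a sign condition on a polynomial in variable 0. Its coefficients depend on [c], but
    its size is bounded by that of the formal polynomial [abstrX], which makes [D] uniform in [c].
    Binary connectives add the two counts. *)
Lemma qf_eval_changes (f : Ord.formula R) : Ord.qf_form f -> Ord.rformula f ->
  exists D : nat, forall c x s, path <%R x s ->
    (changes (fun t => Ord.qf_eval [:: t; c] f) x s <= D)%N.
Proof.
have atom (t1 t2 : GRing.term R) (g : R -> bool) (h : R -> R -> bool) :
  (forall a b, h a b = g (Num.sg (a - b))) ->
  GRing.rterm t1 && GRing.rterm t2 ->
  exists D : nat, forall c x s, path <%R x s ->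
    (changes (fun t => h (GRing.eval [:: t; c] t1) (GRing.eval [:: t; c] t2)) x s <= D)%N.
  move=> hg /andP[r1 r2].
  pose pp c i := qe_rcf.eval_poly [:: 0; c] (qe_rcf.abstrX 0 (qe_rcf.to_rterm i)) : {poly R}.
  have ppE c t i : GRing.rterm i -> GRing.eval [:: t; c] i = (pp c i).[t].
    by move=> ri; rewrite qe_rcf.abstrXP /= qe_rcf.evalE qe_rcf.to_rtermE.
  exists ((maxn (size (qe_rcf.abstrX 0 (qe_rcf.to_rterm t1)))
        (size (qe_rcf.abstrX 0 (qe_rcf.to_rterm t2)))).*2)%N => c x s xs.
  rewrite (@eq_changes _ _ _ (g \o (fun t => Num.sg (pp c t1 - pp c t2).[t]))); last first.
    by move=> t; rewrite /= hg !ppE // hornerD hornerN.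
  apply: (leq_trans (changes_comp _ _ _ _)); apply: (leq_trans (changes_sg_poly _ xs)).
  rewrite leq_double; apply: (leq_trans (size_polyD _ _)); rewrite size_polyN geq_max !leq_max.
  have szP i : (size (pp c i) <= size (qe_rcf.abstrX 0 (qe_rcf.to_rterm i)))%N.
    by rewrite /pp qe_rcf.eval_polyP; apply: (leq_trans (size_Poly _)); rewrite size_map.
  by rewrite !szP orbT.
elim: f => //=.
- by move=> b _ _; exists 0%N => c x s _; elim: s x => //= y s IH x; rewrite eqxx IH.
- move=> t1 t2 _; apply: (atom t1 t2 (fun u => u == 0) (fun a b => a == b)) => a b.
  by rewrite sgr_eq0 subr_eq0.
- move=> t1 t2 _; apply: (atom t1 t2 (fun u => u < 0) (fun a b => a < b)) => a b.
  by rewrite sgr_lt0 subr_lt0.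
- move=> t1 t2 _; apply: (atom t1 t2 (fun u => u <= 0) (fun a b => a <= b)) => a b.
  by rewrite sgr_le0 subr_le0.
- move=> f1 H1 f2 H2 /andP[q1 q2] /andP[r1 r2].
  have [D1 {}H1] := H1 q1 r1; have [D2 {}H2] := H2 q2 r2; exists (D1 + D2)%N => c x s xs.
  by apply: (leq_trans (changes_le_binop andb _ _ _ _)); rewrite leq_add ?H1 ?H2.
- move=> f1 H1 f2 H2 /andP[q1 q2] /andP[r1 r2].
  have [D1 {}H1] := H1 q1 r1; have [D2 {}H2] := H2 q2 r2; exists (D1 + D2)%N => c x s xs.
  by apply: (leq_trans (changes_le_binop orb _ _ _ _)); rewrite leq_add ?H1 ?H2.
- move=> f1 H1 f2 H2 /andP[q1 q2] /andP[r1 r2].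
  have [D1 {}H1] := H1 q1 r1; have [D2 {}H2] := H2 q2 r2; exists (D1 + D2)%N => c x s xs.
  by apply: (leq_trans (changes_le_binop implb _ _ _ _)); rewrite leq_add ?H1 ?H2.
- move=> f1 H1 q1 r1; have [D1 {}H1] := H1 q1 r1; exists D1 => c x s xs.
  exact: (leq_trans (changes_comp negb _ _ _) (H1 c x s xs)).
Qed.

(* rho n is the value of variable n; only finitely many variables may be nonzero. *)
Definition definable (P : (nat -> R) -> Prop) :=
  exists f : Ord.formula R, forall e, P (nth 0 e) <-> Ord.holds e f.

Definition rel_definable (P : R -> R -> Prop) := definable (fun rho => P (rho 0%N) (rho 1%N)).

Lemma definable_changes (P : R -> R -> Prop) : rel_definable P ->
  exists (D : nat) (b : R -> R -> bool), (forall t c, P t c <-> b t c) /\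
    forall c x s, path <%R x s -> (changes (b^~ c) x s <= D)%N.
Proof.
move=> [f0 hf0].
pose f := Ord.to_rform f0.
have rf : Ord.rformula f by exact: Ord.to_rform_rformula.
have /andP[q r] := Ord.quantifier_elim_wf (@qe_rcf.wf_QE_wproj R) rf.
have [D HD] := qf_eval_changes q r.
exists D, (fun t c => Ord.qf_eval [:: t; c] (Ord.quantifier_elim (fun i bc => qe_rcf.qfr_to_formula (@qe_rcf.wproj R i bc)) f)); split=> // t c.
have := Ord.quantifier_elim_rformP (@qe_rcf.wf_QE_wproj R) (@qe_rcf.valid_QE_wproj R) [:: t; c] rf.
move=> h; rewrite (hf0 [:: t; c]) -(Ord.to_rformP _ f0).
by split=> [/h|/h].
Qed.

(** If no germ existed at [0+], every chain could be extended to the left by a point where the truth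
    value differs from that at its head, and the number of changes would be unbounded. *)
Lemma definable_germ (P : R -> R -> Prop) : rel_definable P -> forall c,
  exists2 d : R, 0 < d & (forall t, 0 < t < d -> P t c) \/ (forall t, 0 < t < d -> ~ P t c).
Proof.
move=> /definable_changes[D [b [bP Hb]]] c.
suff [d d0 H] : exists2 d : R, 0 < d & forall t u, 0 < t < d -> 0 < u < d -> b t c = b u c.
  exists d => //; have d2 : 0 < d / 2 < d by apply/andP; split; lra.
  case e : (b (d / 2) c); [left|right] => t ti; last by move/bP; rewrite (H t (d / 2)) // e.
  by apply/bP; rewrite (H t (d / 2)).
apply: contrapT => nH.
have {}nH d : 0 < d -> exists t u, [/\ 0 < t < d, 0 < u < d & b t c != b u c].
  move=> d0; apply: contrapT => nE; apply: nH; exists d => // t u ht hu.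
  by apply/eqP; apply: contrapT => /negP ne; apply: nE; exists t, u.
suff /(_ D.+1)[x [s [_ xs]]] : forall m, exists x s, [/\ 0 < x, path <%R x s &
    (m <= changes (b^~ c) x s)%N] by move=> le; have := leq_trans le (Hb c x s xs); rewrite ltnn.
elim=> [|m [x [s [x0 xs le]]]]; first by exists 1, [::]; split.
have [t [u [/andP[t0 tx] /andP[u0 ux] ne]]] := nH x x0.
have [y [y0 yx ne']] : exists y, [/\ 0 < y, y < x & b y c != b x c].
  have [e|ne'] := eqVneq (b t c) (b x c); last by exists t; split.
  by exists u; split => //; rewrite -e eq_sym.
by exists y, (x :: s); split => //=; rewrite ?yx // ne' add1n ltnS.
Qed.

Lemma eq_definable (P Q : (nat -> R) -> Prop) :
  (forall rho, P rho <-> Q rho) -> definable P -> definable Q.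
Proof. by move=> E [f hf]; exists f => e; rewrite -E. Qed.

Lemma definable_and (P Q : (nat -> R) -> Prop) :
  definable P -> definable Q -> definable (fun rho => P rho /\ Q rho).
Proof. by move=> [f hf] [g hg]; exists (Ord.And f g) => e /=; rewrite hf hg. Qed.

Lemma definable_imp (P Q : (nat -> R) -> Prop) :
  definable P -> definable Q -> definable (fun rho => P rho -> Q rho).
Proof. by move=> [f hf] [g hg]; exists (Ord.Implies f g) => e /=; rewrite hf hg. Qed.

Lemma definable_not (P : (nat -> R) -> Prop) :
  definable P -> definable (fun rho => ~ P rho).
Proof. by move=> [f hf]; exists (Ord.Not f) => e /=; rewrite hf. Qed.

Definition upd (i : nat) (v : R) (rho : nat -> R) n := if n == i then v else rho n.

Lemma definable_ex i (P : (nat -> R) -> Prop) :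
  definable P -> definable (fun rho => exists v, P (upd i v rho)).
Proof.
move=> [f hf]; exists (Ord.Exists i f) => e /=.
have E v : upd i v (nth 0 e) = nth 0 (set_nth 0 e i v).
  by apply/funext => n; rewrite nth_set_nth.
by split=> -[v hv]; exists v; move: hv; rewrite E => /hf.
Qed.

(** A quantifier over vectors is a block of scalar quantifiers. The witness is a function on all of
    [nat], read only inside the block, so the induction on [m] involves no vectors of varying
    length. *)
Lemma definable_ex_block b m (P : (nat -> R) -> Prop) : definable P ->
  definable (fun rho => exists y : nat -> R,
    P (fun n => if (b <= n < b + m)%N then y n else rho n)).
Proof.
elim: m P => [|m IH] P dP.
  have E rho (y : nat -> R) : (fun n => if (b <= n < b + 0)%N then y n else rho n) = rho.
    by apply/funext => n; rewrite addn0 ltnNge; case: (b <= n)%N.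
  by apply: eq_definable dP => rho; split=> [h|[y]]; [exists rho; rewrite E|rewrite E].
apply: eq_definable (IH _ (definable_ex (b + m) dP)) => rho.
have E (y : nat -> R) v : upd (b + m) v (fun n => if (b <= n < b + m)%N then y n else rho n) =
    (fun n => if (b <= n < b + m.+1)%N then upd (b + m) v y n else rho n).
  apply/funext => n; rewrite /upd; case: eqP => [->|ne].
    by rewrite leq_addr addnS ltnSn.
  by rewrite addnS ltnS [(n <= _)%N]leq_eqVlt (introF eqP ne).
split=> -[y]; first by move=> [v]; rewrite E => h; exists (upd (b + m) v y).
move=> h; exists y, (y (b + m)%N); rewrite E; move: h.
by congr (P _); apply/funext => n; rewrite /upd; case: eqP => [->|].
Qed.

End Definable.

(** * Polynomial functions and first-order formulas about vectors *)

Section PolyFun.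
Variables (R : rcfType) (N : nat).
Local Notation V := 'rV[R]_N.

(** An inductive closure rather than a type of multivariate polynomials: first-order terms, bounds,
    Lipschitz constants and continuity all follow by induction on the derivation. *)
Inductive polyf : (V -> R) -> Prop :=
| polyf_var i : polyf (fun x => x 0 i)
| polyf_cst c : polyf (fun=> c)
| polyfD p q : polyf p -> polyf q -> polyf (fun x => p x + q x)
| polyfM p q : polyf p -> polyf q -> polyf (fun x => p x * q x).

Lemma eq_polyf (p q : V -> R) : p =1 q -> polyf p -> polyf q.
Proof. by move=> /funext ->. Qed.

Lemma polyfN p : polyf p -> polyf (fun x => - p x).
Proof.
by move=> hp; apply: (eq_polyf (p := fun x => -1 * p x)) => [x|]; [rewrite mulN1r|exact: polyfM (polyf_cst _) hp].
Qed.

Lemma polyfB p q : polyf p -> polyf q -> polyf (fun x => p x - q x).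
Proof. by move=> hp hq; apply: polyfD hp (polyfN hq). Qed.

Lemma polyf_sum (I : Type) (r : seq I) (P : pred I) (F : I -> V -> R) :
  (forall i, P i -> polyf (F i)) -> polyf (fun x => \sum_(i <- r | P i) F i x).
Proof.
move=> hF; elim: r => [|i r IH].
  by apply: (eq_polyf _ (polyf_cst 0)) => x; rewrite big_nil.
case: (boolP (P i)) => Pi.
  by apply: (eq_polyf _ (polyfD (hF i Pi) IH)) => x; rewrite big_cons Pi.
by apply: (eq_polyf _ IH) => x; rewrite big_cons (negbTE Pi).
Qed.

Lemma polyf_prod (I : Type) (r : seq I) (P : pred I) (F : I -> V -> R) :
  (forall i, P i -> polyf (F i)) -> polyf (fun x => \prod_(i <- r | P i) F i x).
Proof.
move=> hF; elim: r => [|i r IH].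
  by apply: (eq_polyf _ (polyf_cst 1)) => x; rewrite big_nil.
case: (boolP (P i)) => Pi.
  by apply: (eq_polyf _ (polyfM (hF i Pi) IH)) => x; rewrite big_cons Pi.
by apply: (eq_polyf _ IH) => x; rewrite big_cons (negbTE Pi).
Qed.

Definition slot (b : nat) (rho : nat -> R) : V := \row_(i < N) rho (b + i)%N.

Lemma polyf_term b p : polyf p ->
  exists t : GRing.term R, forall e, GRing.eval e t = p (slot b (nth 0 e)).
Proof.
elim=> [i|c|q r _ [t ht] _ [u hu]|q r _ [t ht] _ [u hu]].
- by exists (GRing.Var _ (b + i)%N) => e /=; rewrite mxE.
- by exists (GRing.Const c).
- by exists (GRing.Add t u) => e /=; rewrite ht hu.
- by exists (GRing.Mul t u) => e /=; rewrite ht hu.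
Qed.

Definition in_cube (B : R) (x : V) := forall i, `|x 0 i| <= B.
Definition dist1 (x y : V) : R := \sum_i `|x 0 i - y 0 i|.

Lemma dist1_ge0 x y : 0 <= dist1 x y.
Proof. by apply: sumr_ge0. Qed.

Lemma dist1C x y : dist1 x y = dist1 y x.
Proof. by apply: eq_bigr => i _; rewrite distrC. Qed.

Lemma coord_le_dist1 (x y : V) i : `|x 0 i - y 0 i| <= dist1 x y.
Proof. by rewrite /dist1 (bigD1 i) //= lerDl sumr_ge0. Qed.

Lemma polyf_bounded B p : polyf p -> exists2 C, 0 < C & forall x, in_cube B x -> `|p x| <= C.
Proof.
elim=> [i|c|q r _ [C C0 hC] _ [D D0 hD]|q r _ [C C0 hC] _ [D D0 hD]].
- exists (`|B| + 1); first by rewrite ltr_wpDl.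
  by move=> x hx; rewrite (le_trans (hx i)) // (le_trans (ler_norm B)) // lerDl.
- by exists (`|c| + 1) => [|x _]; [rewrite ltr_wpDl|rewrite lerDl].
- exists (C + D) => [|x hx]; first exact: addr_gt0.
  by rewrite (le_trans (ler_normD _ _)) // lerD ?hC ?hD.
- exists (C * D) => [|x hx]; first exact: mulr_gt0.
  by rewrite normrM ler_pM ?hC ?hD.
Qed.

Lemma polyf_lipschitz B p : polyf p ->
  exists2 C, 0 < C & forall x y, in_cube B x -> in_cube B y -> `|p x - p y| <= C * dist1 x y.
Proof.
elim=> [i|c|q r _ [C C0 hC] _ [D D0 hD]|q r pq [C C0 hC] pr [D D0 hD]].
- by exists 1 => // x y _ _; rewrite mul1r coord_le_dist1.
- by exists 1 => // x y _ _; rewrite subrr normr0 mul1r dist1_ge0.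
- exists (C + D) => [|x y hx hy]; first exact: addr_gt0.
  rewrite opprD addrACA mulrDl (le_trans (ler_normD _ _)) // lerD ?hC ?hD //.
- have [Q Q0 hQ] := polyf_bounded B pq; have [S S0 hS] := polyf_bounded B pr.
  exists (S * C + Q * D) => [|x y hx hy]; first by rewrite addr_gt0 ?mulr_gt0.
  have -> : q x * r x - q y * r y = r x * (q x - q y) + q y * (r x - r y) by ring.
  rewrite (le_trans (ler_normD _ _)) // mulrDl -!mulrA !normrM.
  by rewrite lerD // ler_pM ?hC ?hD ?hQ ?hS.
Qed.

(* Relations in reals t, c (variables 0, 1) and vectors x, y (the next two blocks of N variables). *)
Definition tdefinable (P : R -> R -> V -> V -> Prop) :=
  definable (fun rho : nat -> R => P (rho 0%N) (rho 1%N) (slot 2 rho) (slot (2 + N) rho)).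

Definition tterm (p : R -> R -> V -> V -> R) := exists t : GRing.term R, forall e,
  GRing.eval e t = p e`_0 e`_1 (slot 2 (nth 0 e)) (slot (2 + N) (nth 0 e)).

Lemma tterm_t : tterm (fun t _ _ _ => t).
Proof. by exists (GRing.Var _ 0%N). Qed.
Lemma tterm_c : tterm (fun _ c _ _ => c).
Proof. by exists (GRing.Var _ 1%N). Qed.
Lemma tterm_cst a : tterm (fun _ _ _ _ => a).
Proof. by exists (GRing.Const a). Qed.
Lemma tterm_x p : polyf p -> tterm (fun _ _ x _ => p x).
Proof. exact: polyf_term. Qed.
Lemma tterm_y p : polyf p -> tterm (fun _ _ _ y => p y).
Proof. exact: polyf_term. Qed.

Lemma tdef_le p q : tterm p -> tterm q -> tdefinable (fun t c x y => p t c x y <= q t c x y).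
Proof. by move=> [u hu] [v hv]; exists (Ord.Le u v) => e /=; rewrite hu hv. Qed.
Lemma tdef_eq p q : tterm p -> tterm q -> tdefinable (fun t c x y => p t c x y = q t c x y).
Proof. by move=> [u hu] [v hv]; exists (Ord.Equal u v) => e /=; rewrite hu hv. Qed.
Lemma tdef_lt p q : tterm p -> tterm q -> tdefinable (fun t c x y => p t c x y < q t c x y).
Proof. by move=> [u hu] [v hv]; exists (Ord.Lt u v) => e /=; rewrite hu hv. Qed.
Lemma tdef_and P Q : tdefinable P -> tdefinable Q ->
  tdefinable (fun t c x y => P t c x y /\ Q t c x y).
Proof. exact: definable_and. Qed.
Lemma tdef_imp P Q : tdefinable P -> tdefinable Q ->
  tdefinable (fun t c x y => P t c x y -> Q t c x y).
Proof. exact: definable_imp. Qed.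
Lemma tdef_not P : tdefinable P -> tdefinable (fun t c x y => ~ P t c x y).
Proof. exact: definable_not. Qed.

Lemma slot_block b (x : V) (rho : nat -> R) (y : nat -> R) : (forall i : 'I_N, y (b + i)%N = x 0 i) ->
  slot b (fun n => if (b <= n < b + N)%N then y n else rho n) = x.
Proof. by move=> hy; apply/rowP => i; rewrite mxE leq_addr ltn_add2l ltn_ord hy. Qed.

Definition block b (x : V) (n : nat) : R := if insub (n - b)%N is Some i then x 0 i else 0.

Lemma blockE b x (i : 'I_N) : block b x (b + i) = x 0 i.
Proof. by rewrite /block addKn valK. Qed.

Lemma tdef_ex1 P : tdefinable P -> tdefinable (fun t c x y => exists x', P t c x' y).
Proof.
move=> /(definable_ex_block 2 N); apply: eq_definable => rho; cbv beta.
have E (z : nat -> R) : slot (2 + N) (fun n => if (2 <= n < 2 + N)%N then z n else rho n) = slot (2 + N) rho.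
  apply/rowP => i; rewrite !mxE ifF //; apply/negbTE; lia.
split=> -[z]; first by rewrite E => h; eexists; exact: h.
by move=> h; exists (block 2 z); rewrite E (slot_block (x := z)) // => i; rewrite blockE.
Qed.

Lemma tdef_ex2 P : tdefinable P -> tdefinable (fun t c x y => exists y', P t c x y').
Proof.
move=> /(definable_ex_block (2 + N) N); apply: eq_definable => rho; cbv beta.
have E (z : nat -> R) : slot 2 (fun n => if (2 + N <= n < 2 + N + N)%N then z n else rho n) = slot 2 rho.
  apply/rowP => i; rewrite !mxE ifF //; apply/negbTE; have := ltn_ord i; lia.
split=> -[z]; first by rewrite E => h; eexists; exact: h.
by move=> h; exists (block (2 + N) z); rewrite E (slot_block (x := z)) // => i; rewrite blockE.
Qed.

Lemma tdef_all1 P : tdefinable P -> tdefinable (fun t c x y => forall x', P t c x' y).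
Proof.
move=> /tdef_not/tdef_ex1/tdef_not; apply: eq_definable => rho; split=> [h x'|h [x' hx]].
  by apply: contrapT => hx; apply: h; exists x'.
exact: hx.
Qed.

Lemma tdef_all2 P : tdefinable P -> tdefinable (fun t c x y => forall y', P t c x y').
Proof.
move=> /tdef_not/tdef_ex2/tdef_not; apply: eq_definable => rho; split=> [h x'|h [x' hx]].
  by apply: contrapT => hx; apply: h; exists x'.
exact: hx.
Qed.

Lemma tdefinable_rel (P : R -> R -> Prop) : tdefinable (fun t c _ _ => P t c) -> rel_definable P.
Proof. by []. Qed.
End PolyFun.
Arguments polyf_var {R N} i.
Arguments polyf_cst {R N} c.
Arguments tterm_t {R N}.
Arguments tterm_c {R N}.
Arguments tterm_cst {R N} a.

(** * Variation and level crossings *)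

Section Variation.
Variable R : realFieldType.

Fixpoint chain_sum (A : Type) (d : A -> A -> R) (x : A) (s : seq A) : R :=
  if s is y :: s' then d x y + chain_sum d y s' else 0.

Lemma chain_sum_cat (A : Type) (d : A -> A -> R) x s1 s2 :
  chain_sum d x (s1 ++ s2) = chain_sum d x s1 + chain_sum d (last x s1) s2.
Proof. by elim: s1 x => [|y s1 IH] x /=; rewrite ?add0r // IH addrA. Qed.

Lemma chain_sum_exchange (A I : Type) (r : seq I) (d : I -> A -> A -> R) x s :
  chain_sum (fun a b => \sum_(i <- r) d i a b) x s = \sum_(i <- r) chain_sum (d i) x s.
Proof.
elim: s x => [|y s IH] x /=; first by rewrite big1.
by rewrite IH -big_split.
Qed.

Lemma le_chain_sum (A : eqType) (d d' : A -> A -> R) x s :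
  (forall a b, a \in x :: s -> b \in x :: s -> d a b <= d' a b) ->
  chain_sum d x s <= chain_sum d' x s.
Proof.
elim: s x => //= y s IH x h; apply: lerD; first by apply: h; rewrite !inE eqxx ?orbT.
by apply: IH => a b ha hb; apply: h; rewrite inE ?ha ?hb orbT.
Qed.

Lemma chain_sum_changes (A : Type) (T : eqType) (b : A -> T) (w : R) x s :
  chain_sum (fun u v => (b u != b v)%:R * w) x s = (changes b x s)%:R * w.
Proof. by elim: s x => [|y s IH] x /=; rewrite ?mul0r // IH natrD mulrDl. Qed.

Lemma le_chain_sum_path (A : eqType) (r : rel A) (d d' : A -> A -> R) x s :
  path r x s ->
  (forall a b, a \in x :: s -> b \in x :: s -> r a b -> d a b <= d' a b) ->
  chain_sum d x s <= chain_sum d' x s.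
Proof.
elim: s x => //= y s IH x /andP[rxy ps] h; apply: lerD.
  by apply: h; rewrite // !inE eqxx ?orbT.
by apply: IH => // a b ha hb; apply: h; rewrite inE ?ha ?hb orbT.
Qed.

Lemma chain_sum_telescope x s : chain_sum (fun a b : R => b - a) x s = last x s - x.
Proof. by elim: s x => [|y s IH] x /=; rewrite ?subrr // IH; ring. Qed.

Lemma chain_sumZ (A : Type) (k : R) (d : A -> A -> R) x s :
  chain_sum (fun a b => k * d a b) x s = k * chain_sum d x s.
Proof. by elim: s x => [|y s IH] x /=; rewrite ?mulr0 // IH mulrDr. Qed.

(* Banach indicatrix: integrate over c the number of crossings of level c. *)
Lemma variation_le_crossings (A : eqType) (f : A -> R) (D : nat) (lo hi : R) x s :
  (forall a, a \in x :: s -> lo <= f a <= hi) ->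
  (forall c, (changes (fun a => (c < f a)%R) x s <= D)%N) ->
  chain_sum (fun a b => `|f a - f b|) x s <= D%:R * (hi - lo).
Proof.
move=> hf hD.
(* The integral over levels becomes a finite sum over the values taken on the chain, weighted by the
   gaps [e] between consecutive values; a difference of two values is the total weight of the levels
   that separate them. *)
pose w := sort <=%R (undup (map f (x :: s))).
have memw a : a \in x :: s -> f a \in w.
  by move=> ha; rewrite mem_sort mem_undup map_f.
have sw : sorted <%R w by rewrite sort_lt_sorted undup_uniq.
pose M := (size w).-1.
have w0 : (0 < size w)%N by case: (w) (memw x (mem_head _ _)).
have szw : size w = M.+1 by rewrite /M prednK.
pose e k := w`_k.+1 - w`_k.
have hE u : u \in w -> \sum_(0 <= k < M) (w`_k < u)%R%:R * e k = u - w`_0.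
  move=> uw; set j := index u w.
  have jw : (j < size w)%N by rewrite index_mem.
  have jM : (j <= M)%N by rewrite -ltnS -szw.
  rewrite -{2}(nth_index 0 uw) -/j -(telescope_sumr _ (leq0n j)).
  rewrite (big_nat_widen _ _ _ _ _ jM) [RHS]big_mkcond /= big_nat_cond [RHS]big_nat_cond.
  apply: eq_bigr => k /andP[/andP[_ kM] _].
  have kw : (k < size w)%N by rewrite szw ltnW.
  rewrite -{1}(nth_index 0 uw) -/j (lt_sorted_ltn_nth 0 sw) ?inE //.
  by case: (k < j)%N; rewrite ?mul1r ?mul0r.
have e0 k : (k < M)%N -> 0 <= e k.
  by move=> kM; rewrite subr_ge0 ltW // (lt_sorted_ltn_nth 0 sw) ?inE ?szw ?ltnS ?(ltnW kM).
have sume : \sum_(0 <= k < M) e k <= hi - lo.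
  rewrite telescope_sumr //.
  have bnd u : u \in w -> lo <= u <= hi.
    by rewrite mem_sort mem_undup => /mapP[a ha ->]; exact: hf.
  have /andP[_ h1] : lo <= w`_M <= hi by apply: bnd; rewrite mem_nth // szw.
  have /andP[h2 _] : lo <= w`_0 <= hi by apply: bnd; rewrite mem_nth.
  lra.
pose d a b := \sum_(0 <= k < M) ((w`_k < f a)%R != (w`_k < f b)%R)%:R * e k.
apply: (@le_trans _ _ (chain_sum d x s)).
  apply: le_chain_sum => a b /memw ha /memw hb.
  have -> : f a - f b = (f a - w`_0) - (f b - w`_0) by ring.
  rewrite -!hE // -sumrB (le_trans (ler_norm_sum _ _ _)) //.
  rewrite /d big_nat_cond [leRHS]big_nat_cond; apply: ler_sum => k /andP[/andP[_ kM] _].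
  rewrite -mulrBl normrM (ger0_norm (e0 k kM)) ler_wpM2r ?e0 //.
  by case: (_ < f a); case: (_ < f b); rewrite ?subrr ?subr0 ?sub0r ?normrN ?normr0 ?normr1.
rewrite chain_sum_exchange; apply: (@le_trans _ _ (\sum_(0 <= k < M) D%:R * e k)); last first.
  by rewrite -mulr_sumr ler_wpM2l.
rewrite big_nat_cond [leRHS]big_nat_cond; apply: ler_sum => k /andP[/andP[_ kM] _].
rewrite (chain_sum_changes (fun a => w`_k < f a)) ler_wpM2r ?e0 // ler_nat; exact: hD.
Qed.
End Variation.

(** * Desingularization *)

Section Compactness.
Variables (R : realType) (N : nat).
Local Notation V := 'rV[R]_N.

Lemma polyf_continuous (p : V -> R) : polyf p -> continuous p.
Proof.
elim=> [i|c|q r _ hq _ hr|q r _ hq _ hr].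
- exact: coord_continuous.
- exact: cst_continuous.
- by move=> x; apply: (@continuousD _ R^o _ q r x); [exact: hq|exact: hr].
- by move=> x; apply: (@continuousM _ _ q r x); [exact: hq|exact: hr].
Qed.

Lemma compact_cube (B : R) : compact [set x : V | in_cube B x].
Proof.
have -> : [set x : V | in_cube B x] = [set x : V | forall i, (`[- B, B]%classic : set R) (x ord0 i)].
  by apply/seteqP; split=> x /= h i; have := h i; rewrite /= in_itv /= ler_norml.
by apply: (@rV_compact R N (fun=> `[- B, B]%classic)) => i; exact: segment_compact.
Qed.

Lemma closed_polyf_le (p q : V -> R) : polyf p -> polyf q -> closed [set x | p x <= q x].
Proof.
move=> hp hq.
have -> : [set x | p x <= q x] = (fun x => p x - q x) @^-1` [set y : R | y <= 0].
  by apply/seteqP; split=> x /=; rewrite subr_le0.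
apply: closed_comp; last exact: closed_le.
by move=> x _; exact: (polyf_continuous (polyfB hp hq)).
Qed.

Lemma compact_polyf_min (K : set V) (p : V -> R) : compact K -> K !=set0 -> polyf p ->
  exists2 x, K x & forall y, K y -> p x <= p y.
Proof.
move=> cK K0 /polyf_continuous cp.
have [x /set_mem Kx h] := compact_EVT_min K0 cK (@continuous_subspaceT _ _ K _ cp).
by exists x => // y Ky; apply: h; rewrite inE.
Qed.

Lemma compact_polyf_max (K : set V) (p : V -> R) : compact K -> K !=set0 -> polyf p ->
  exists2 x, K x & forall y, K y -> p y <= p x.
Proof.
move=> cK K0 hp; have [x Kx h] := compact_polyf_min cK K0 (polyfN hp).
by exists x => // y Ky; rewrite -lerN2 h.
Qed.
End Compactness.

Lemma path_lt_bounds (R : realDomainType) (a : R) s t : path <%R a s -> t \in a :: s ->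
  a <= t <= last a s.
Proof.
elim: s a t => [|b s IH] a t /=; first by rewrite inE => _ /eqP ->; rewrite lexx.
move=> /andP[ab ps]; rewrite inE => /predU1P[->|/(IH _ _ ps)/andP[bt ->]].
  have /andP[_ h] := IH b b ps (mem_head _ _).
  by rewrite lexx (le_trans (ltW ab) h).
by rewrite (le_trans (ltW ab) bt).
Qed.

(** [W t] is the supremum of the sums over chains that start at [t] and end below [d0].
    Concatenating a chain with one that starts at its last point gives the inequality. *)
Lemma variation_potential (R : realType) (dd : R -> R -> R) (d0 L : R) :
  (forall a b, 0 <= dd a b) ->
  (forall a s, 0 < a -> path <%R a s -> last a s < d0 -> chain_sum dd a s <= L) ->
  exists W : R -> R, (forall t, 0 < t < d0 -> 0 <= W t <= L) /\
    forall a s, 0 < a -> path <%R a s -> last a s < d0 ->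
      chain_sum dd a s <= W a - W (last a s).
Proof.
move=> dd0 bnd.
pose S t : set R := [set v | exists s, [/\ path <%R t s, last t s < d0 & v = chain_sum dd t s]].
have ubS t : 0 < t -> has_ubound (S t).
  by move=> t0; exists L => _ [s [ps ls ->]]; exact: bnd.
exists (sup \o S); split=> [t /andP[t0 td]|a s a0 ps ls] /=.
  have S0 : S t 0 by exists [::].
  rewrite (ub_le_sup (ubS t t0) S0) /=; apply: ge_sup; first by exists 0.
  by move=> _ [s [ps ls ->]]; exact: bnd.
have /andP[alast _] := path_lt_bounds ps (mem_last a s).
rewrite lerBrDr -lerBrDl; apply: ge_sup; first by exists 0, [::].
move=> _ [s' [ps' ls' ->]]; rewrite lerBrDl -chain_sum_cat.
apply: (ub_le_sup (ubS a a0)); exists (s ++ s').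
by rewrite cat_path ps last_cat.
Qed.

(** * The Kurdyka-Lojasiewicz inequality on a compact algebraic set *)

Section Desingularization.
Variables (R : realType) (N : nat).
Local Notation V := 'rV[R]_N.
Variables (B C : R) (H f G : V -> R).
Hypotheses (pH : polyf H) (pf : polyf f) (pG : polyf G).
Hypothesis H_cube : forall x, H x = 0 -> in_cube B x.
Hypothesis G_ge0 : forall x, 0 <= G x.
Hypothesis C_gt0 : 0 < C.
(** [Num.sqrt (G x)] stands for the norm of the gradient of [f] along the zero set of [H], and [C]
    for a second-order bound. *)
Hypothesis f_slope : forall x y, H x = 0 -> H y = 0 ->
  `|f x - f y| <= (Num.sqrt (G x) + C * dist1 x y) * dist1 x y.

Definition minset (h : V -> R) (Q : R -> V -> Prop) t x :=
  Q t x /\ forall y, Q t y -> h x <= h y.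
Definition level t x := H x = 0 /\ f x = t.
Definition argmin := minset G level.
(** Lexicographic tie-breaking singles out one minimizer of [G] by a first-order formula, which an
    arbitrary choice among the minimizers would not provide. *)
Definition select := foldl (fun Q i => minset (fun x => x 0 i) Q) argmin (enum 'I_N).

Definition definable2 (Q : R -> V -> Prop) :=
  @tdefinable R N (fun t c x y => Q t x) /\ @tdefinable R N (fun t c x y => Q t y).

Lemma definable2_level : definable2 level.
Proof.
split; apply: tdef_and; apply: tdef_eq; rewrite -/(tterm _).
all: try exact: tterm_x.
all: try exact: tterm_y.
all: try exact: tterm_cst.
all: exact: tterm_t.
Qed.

(* Keeping Q definable in either vector slot lets the other slot be the bound variable. *)
Lemma definable2_minset h Q : polyf h -> definable2 Q -> definable2 (minset h Q).
Proof.
move=> ph [d1 d2]; split; apply: tdef_and => //.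
  by apply: tdef_all2; apply: tdef_imp => //; apply: tdef_le; [exact: tterm_x|exact: tterm_y].
by apply: tdef_all1; apply: tdef_imp => //; apply: tdef_le; [exact: tterm_y|exact: tterm_x].
Qed.

Lemma definable2_select : definable2 select.
Proof.
rewrite /select; have : definable2 argmin by exact: definable2_minset pG definable2_level.
elim: (enum 'I_N) argmin => //= i l IH Q dQ.
by apply: IH; apply: definable2_minset dQ; exact: polyf_var.
Qed.

Lemma compact_zero : compact [set x | H x = 0].
Proof.
have -> : [set x | H x = 0] = [set x : V | in_cube B x] `&` ([set x | H x <= 0] `&` [set x | 0 <= H x]).
  apply/seteqP; split=> x /=.
    by move=> h; split; [exact: H_cube|rewrite h lexx].
  by move=> [_ [h1 h2]]; apply/eqP; rewrite eq_le h1 h2.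
apply: compact_closedI; [exact: compact_cube|apply: closedI].
  exact: closed_polyf_le pH (polyf_cst _).
exact: closed_polyf_le (polyf_cst _) pH.
Qed.

Lemma compact_band a b : compact [set x | H x = 0 /\ a <= f x <= b].
Proof.
have -> : [set x | H x = 0 /\ a <= f x <= b] =
    [set x | H x = 0] `&` ([set x | a <= f x] `&` [set x | f x <= b]).
  by apply/seteqP; split=> x /= [h]; [move=> /andP[]|move=> [-> ->]].
apply: compact_closedI; [exact: compact_zero|apply: closedI].
  exact: closed_polyf_le (polyf_cst _) pf.
exact: closed_polyf_le pf (polyf_cst _).
Qed.

Lemma compact_minset h (Q : R -> V -> Prop) t : polyf h ->
  compact [set x | Q t x] -> [set x | Q t x] !=set0 ->
  compact [set x | minset h Q t x] /\ [set x | minset h Q t x] !=set0.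
Proof.
move=> ph cQ Q0; have [x Qx hx] := compact_polyf_min cQ Q0 ph.
split; last by exists x.
have -> : [set x | minset h Q t x] = [set x | Q t x] `&` [set y | h y <= h x].
  apply/seteqP; split=> y /= [Qy hy]; split=> //; first exact: hy.
  by move=> z Qz; exact: le_trans hy (hx _ Qz).
exact: compact_closedI cQ (closed_polyf_le ph (polyf_cst _)).
Qed.

Lemma select_fold Q l t : compact [set x | Q t x] -> [set x | Q t x] !=set0 ->
  (exists x, foldl (fun Q i => minset (fun x : V => x 0 i) Q) Q l t x).
Proof.
elim: l Q => [|i l IH] Q cQ Q0 /=; first by have [x] := Q0; exists x.
by have [] := compact_minset (polyf_var i) cQ Q0; exact: IH.
Qed.

Lemma select_sub Q l t x : foldl (fun Q i => minset (fun x : V => x 0 i) Q) Q l t x -> Q t x.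
Proof. by elim: l Q => //= i l IH Q /IH[]. Qed.

Lemma select_eq Q l t x y : foldl (fun Q i => minset (fun x : V => x 0 i) Q) Q l t x ->
  foldl (fun Q i => minset (fun x : V => x 0 i) Q) Q l t y -> {in l, x 0 =1 y 0}.
Proof.
elim: l Q => //= i l IH Q hx hy j; rewrite inE => /predU1P[->|]; last exact: IH hx hy j.
have [Qx mx] := select_sub hx; have [Qy my] := select_sub hy.
by apply/eqP; rewrite eq_le mx ?my.
Qed.

(* 0 on the levels that are not attained *)
Definition section t : V := xget 0 [set x | select t x].

Lemma sectionP t : (exists x, level t x) -> argmin t (section t) /\ select t (section t).
Proof.
move=> [x0 lx0].
have cl : compact [set x | level t x].
  have -> : [set x | level t x] = [set x | H x = 0 /\ t <= f x <= t].
    apply/seteqP; split=> x /= [h e]; split=> //; first by rewrite e lexx.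
    by apply/eqP; rewrite eq_le andbC.
  exact: compact_band.
have l0 : [set x | level t x] !=set0 by exists x0.
have [ca a0] := compact_minset pG cl l0.
have [x sx] := select_fold (enum 'I_N) ca a0.
have ss : select t (section t) by apply: (@xgetPex _ 0 [set x | select t x]); exists x.
by split=> //; exact: select_sub ss.
Qed.

Lemma select_uniq t x y : select t x -> select t y -> x = y.
Proof. by move=> hx hy; apply/rowP => i; apply: (select_eq hx hy); rewrite mem_enum. Qed.

Lemma section_variation : exists L, forall a s, path <%R a s ->
  (forall t, t \in a :: s -> exists x, level t x) ->
  chain_sum (fun u v => dist1 (section u) (section v)) a s <= L.
Proof.
suff /choice[L hL] : forall i : 'I_N, exists L, forall a s, path <%R a s ->
    (forall t, t \in a :: s -> exists x, level t x) ->
    chain_sum (fun u v => `|section u 0 i - section v 0 i|) a s <= L.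
  exists (\sum_i L i) => a s ps hs.
  by rewrite chain_sum_exchange; apply: ler_sum => i _; exact: hL.
move=> i.
(* [section] is a chosen value, not a formula, so level crossings are expressed through [select];
   uniqueness of the selected point makes the two agree on attained levels. *)
pose P t c := exists x, select t x /\ c < x 0 i.
have dP : rel_definable P.
  apply: (@tdefinable_rel R N).
  have := definable2_select => -[d1 _].
  have := tdef_ex1 (tdef_and d1 (tdef_lt tterm_c (tterm_x (polyf_var i)))).
  by [].
have [D [b [bP Hb]]] := definable_changes dP.
exists (D%:R * (B - - B)) => a s ps hs.
apply: variation_le_crossings => [t ht|c].
  have [[[h _] _] _] := sectionP (hs t ht).
  by have := H_cube h i; rewrite ler_norml.
apply: leq_trans (Hb c a s ps); rewrite (@eq_in_changes _ _ _ (b^~ c)) // => t ht /=.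
have [_ st] := sectionP (hs t ht).
apply/idP/idP => [h|/bP[x [sx]]]; last by rewrite (select_uniq st sx).
by apply/bP; exists (section t).
Qed.
Definition section_dist u v := dist1 (section u) (section v).

(** Discrete counterpart of integrating [|f'| <= g |X'|] along the section: each step of the level
    is at most the slope times a displacement, and the displacements add up to at most the drop of
    [W]. *)
Lemma interval_bound (d0 : R) (W : R -> R) a b g :
  (forall t, 0 < t < d0 -> exists x, level t x) ->
  (forall a s, 0 < a -> path <%R a s -> last a s < d0 ->
      chain_sum section_dist a s <= W a - W (last a s)) ->
  0 < a -> a < b -> b < d0 -> 0 < g ->
  (forall t, a <= t <= b -> Num.sqrt (G (section t)) <= g) ->
  b - a <= g * (W a - W b).
Proof.
move=> hlev hW a0 ab bd g0 hg.
set y := W a - W b.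
have y0 : 0 <= y.
  have := hW a [:: b] a0; rewrite /= ab bd addr0 => /(_ isT isT); apply: le_trans.
  exact: dist1_ge0.
apply/ler_addgt0Pr => e e0.
(* Cut [a, b] into steps of length h <= eta^2 / C: a step on which section moves by d satisfies
   h <= (g + C d) d, whence h <= (g + 2 eta) d whether C d <= eta or not. *)
pose eta := e / (2 * (y + 1)).
have y1 : 0 < y + 1 by lra.
have eta0 : 0 < eta by rewrite divr_gt0 ?mulr_gt0.
have eta_y : 2 * eta * y <= e.
  have : e = 2 * eta * y + 2 * eta by rewrite /eta; field; rewrite lt0r_neq0.
  by lra.
pose K := (Num.bound (C * (b - a) / eta ^+ 2)).+1.
pose h := (b - a) / K%:R.
have K0 : 0 < K%:R :> R by rewrite ltr0n.
have h0 : 0 < h by rewrite divr_gt0 // subr_gt0.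
have hC : C * h <= eta ^+ 2.
  have hb : C * (b - a) / eta ^+ 2 < K%:R.
    rewrite (lt_le_trans (archi_boundP _)) ?ler_nat ?leqnSn //.
    by apply: divr_ge0 (sqr_ge0 _); apply: mulr_ge0 (ltW C_gt0) _; rewrite subr_ge0 ltW.
  move: hb; rewrite ltr_pdivrMr ?exprn_gt0 // mulrC [_%:R * _]mulrC => /ltW hb.
  by rewrite /h mulrA ler_pdivrMr // mulrC.
pose st x := x + h.
have itE i : iter i st a = a + h *+ i.
  by elim: i => [|i IH]; rewrite ?addr0 // iterS IH /st mulrSr addrA.
have itb i : (i <= K)%N -> a <= iter i st a <= b.
  move=> iK; rewrite itE lerDl mulrn_wge0 ?(ltW h0) //=.
  have -> : b = a + h *+ K by rewrite -mulr_natr /h mulfVK ?lt0r_neq0 //; ring.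
  by rewrite lerD2l ler_wpMn2l // ltW.
have lastb : last a (traject st (st a) K) = b.
  by rewrite last_traject itE -mulr_natr /h mulfVK ?lt0r_neq0 //; ring.
have ps : path <%R a (traject st (st a) K).
  apply: sub_path (fpath_traject st a K) => u v /= /eqP <-.
  by rewrite /st ltrDl.
have memb t : t \in a :: traject st (st a) K -> a <= t <= b.
  by rewrite -trajectS => /trajectP[i iK ->]; apply: itb.
have := hW a _ a0 ps; rewrite lastb => /(_ bd) hs.
apply: (@le_trans _ _ ((g + 2 * eta) * y)); last first.
  by rewrite mulrDl; lra.
apply: (@le_trans _ _ ((g + 2 * eta) * chain_sum section_dist a (traject st (st a) K))); last first.
  by apply: ler_wpM2l hs; lra.
rewrite -{1}lastb -chain_sum_telescope -chain_sumZ.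
apply: (le_chain_sum_path (fpath_traject st a K)) => u v hu hv /= /eqP uv.
have lu : exists x, level u x.
  by have /andP[h1 h2] := memb u hu; apply: hlev; rewrite (lt_le_trans a0 h1) (le_lt_trans h2 bd).
have lv : exists x, level v x.
  by have /andP[h1 h2] := memb v hv; apply: hlev; rewrite (lt_le_trans a0 h1) (le_lt_trans h2 bd).
have [[[Hu fu] _] _] := sectionP lu; have [[[Hv fv] _] _] := sectionP lv.
have vuh : v - u = h by rewrite -uv /st; ring.
have := f_slope Hu Hv; rewrite fu fv distrC vuh (gtr0_norm h0) /section_dist.
set d := dist1 _ _; have d_ge0 : 0 <= d by exact: dist1_ge0.
move=> hd; have gd := hg u (memb u hu).
have [Cd|Cd] := lerP (C * d) eta.
  apply: (le_trans hd); rewrite ler_wpM2r //.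
  by rewrite mulr_natl mulr2n; lra.
have h2 : eta * eta <= eta * (C * d) by apply: ler_wpM2l; exact: ltW.
have : C * h <= C * (eta * d) by lra.
rewrite ler_pM2l // => hh; apply: (le_trans hh); rewrite ler_wpM2r //; lra.
Qed.

Definition unary_germ (P : R -> Prop) := exists2 d : R, 0 < d &
  (forall t, 0 < t < d -> P t) \/ (forall t, 0 < t < d -> ~ P t).

Lemma tdefinable_germ P : @tdefinable R N (fun t _ _ _ => P t) -> unary_germ P.
Proof. by move=> dP; apply: (@definable_germ R (fun t _ => P t) _ 0); exact: (@tdefinable_rel R N). Qed.

Lemma level_germ : unary_germ (fun t => exists x, level t x).
Proof.
by apply: tdefinable_germ; apply: tdef_ex1; have [] := definable2_level.
Qed.

Theorem desingularization : exists (d0 L : R) (W : R -> R),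
  [/\ 0 < d0, forall u, 0 < u < d0 -> 0 <= W u <= L &
      forall x u, H x = 0 -> 0 < u -> u < f x -> f x < d0 ->
        f x - u <= Num.sqrt (G x) * (W u - W (f x))].
Proof.
have [d1 d1_gt0 [hlev|nlev]] := level_germ; last first.
  (* No small positive level is attained, so the inequality holds vacuously. *)
  exists d1, 0, (fun=> 0); split=> // [u _|x u Hx u0 ux xd]; first by rewrite lexx.
  by case: (nlev (f x)); [rewrite (lt_trans u0)|exists x].
have [L hL] := section_variation.
have hlev' a s : 0 < a -> path <%R a s -> last a s < d1 ->
    forall t, t \in a :: s -> exists x, level t x.
  move=> a0 ps ls t ts; have /andP[h1 h2] := path_lt_bounds ps ts.
  by apply: hlev; rewrite (lt_le_trans a0) ?(le_lt_trans h2).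
have [W [Wb hW]] : exists W : R -> R, (forall t, 0 < t < d1 -> 0 <= W t <= L) /\
    forall a s, 0 < a -> path <%R a s -> last a s < d1 ->
      chain_sum section_dist a s <= W a - W (last a s).
  apply: variation_potential => [a b|a s a0 ps ls]; first exact: dist1_ge0.
  by apply: hL => //; exact: hlev' ls.
(* critical values cannot fill an interval: W would drop by an arbitrarily large amount *)
have [d2 d2_gt0 ncrit] : exists2 d2, 0 < d2 & forall x, H x = 0 -> 0 < f x < d2 -> G x != 0.
  have [d2 d2_gt0 [crit|ncrit]] : unary_germ (fun t => exists x, level t x /\ G x = 0).
    apply: tdefinable_germ; apply: tdef_ex1; apply: tdef_and.
      by have [] := definable2_level.
    by apply: tdef_eq; [exact: tterm_x|exact: tterm_cst].
  - pose b := Num.min d1 d2 / 2; pose a := b / 2.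
    have m0 : 0 < Num.min d1 d2 by rewrite lt_min d1_gt0.
    have [b0 ab] : 0 < b /\ a < b by rewrite /a /b; split; lra.
    have [bd1 bd2] : b < d1 /\ b < d2.
      by apply/andP; rewrite -lt_min /b; lra.
    have a0 : 0 < a by rewrite /a; lra.
    have G0 t : a <= t <= b -> G (section t) = 0.
      move=> /andP[h1 h2]; have [|x [lx Gx]] := crit t; first by lra.
      have [|[_ /(_ _ lx)]] := @sectionP t; first by exists x.
      by rewrite Gx => h _; apply/eqP; rewrite eq_le h G_ge0.
    have key g : 0 < g -> b - a <= g * (W a - W b).
      move=> g0; apply: (interval_bound hlev hW) => // t ht.
      by rewrite G0 // sqrtr0 ltW.
    have := key 1 ltr01; rewrite mul1r => h1.
    have w0 : 0 < W a - W b by lra.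
    have := key ((b - a) / 2 / (W a - W b)); rewrite mulfVK ?lt0r_neq0 // => h2.
    have : 0 < (b - a) / 2 / (W a - W b) by rewrite divr_gt0 //; lra.
    by move=> /h2; lra.
  - exists d2 => // x Hx fx; apply/eqP => Gx; apply: (ncrit (f x)) => //.
    by exists x.
pose d := Num.min d1 d2 / 2.
have m0 : 0 < Num.min d1 d2 by rewrite lt_min d1_gt0.
have d_gt0 : 0 < d by rewrite /d; lra.
have [dd1 dd2] : d < d1 /\ d < d2 by apply/andP; rewrite -lt_min /d; lra.
(* Either G is nondecreasing in the level along minimizers, or it is bounded below near level 0. *)
have [d3 d3_gt0 [mono|nmono]] : unary_germ (fun t => forall x, (H x = 0 /\ t <= f x /\ f x <= d) ->
    exists y, level t y /\ G y <= G x).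
- apply: tdefinable_germ; apply: tdef_all1; apply: tdef_imp.
    apply: tdef_and; first by apply: tdef_eq; [exact: tterm_x|exact: tterm_cst].
    apply: tdef_and; apply: tdef_le; rewrite -/(tterm _); try exact: tterm_x; try exact: tterm_t.
    exact: tterm_cst.
  apply: tdef_ex2; apply: tdef_and; first by have [] := definable2_level.
  by apply: tdef_le; [exact: tterm_y|exact: tterm_x].
- exists (Num.min d d3), L, W; split=> [|u|x u Hx u0 ux].
  + by rewrite lt_min d_gt0.
  + by rewrite lt_min => /and3P[h1 h2 h3]; apply: Wb; rewrite h1 (lt_trans h2).
  rewrite lt_min => /andP[xd xd3].
  (* Applied with [g = Num.sqrt (G x)]: every level [t] between [u] and [f x] carries a point with
     [G] at most [G x], hence so does the minimizer [section t]. *)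
  apply: (interval_bound hlev hW) => //; first exact: lt_trans dd1.
    rewrite sqrtr_gt0 lt0r G_ge0 andbT; apply: ncrit => //.
    by rewrite (lt_trans u0) // (lt_trans xd).
  move=> t /andP[ut tx]; apply: ler_wsqrtr.
  have [||y [ly Gyx]] := mono t _ x.
    by rewrite (lt_le_trans u0) // (le_lt_trans tx).
    by rewrite tx ltW.
  have [|[_ /(_ _ ly)]] := @sectionP t; first by exists y.
  by move=> h _; exact: le_trans h Gyx.
(* [c] is the minimum of [G] on the band [m <= f <= d]. From [x], climb to the highest point [y] of
   level at most [d] with [G y <= G x]. If [y] were below the band, failure of monotonicity at the
   level of [y] would supply a strictly higher point with smaller [G]. *)
have [c c_gt0 hc] : exists2 c, 0 < c & forall x, H x = 0 -> 0 < f x < Num.min d d3 -> c <= G x.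
  pose m := Num.min d d3 / 2.
  have mm0 : 0 < Num.min d d3 by rewrite lt_min d_gt0.
  have m_gt0 : 0 < m by rewrite /m; lra.
  have [md md3] : m < d /\ m < d3 by apply/andP; rewrite -lt_min /m; lra.
  have ne : [set x | H x = 0 /\ m <= f x <= d] !=set0.
    have [|x [Hx fx]] := hlev m; first by rewrite m_gt0 (lt_trans md).
    by exists x; rewrite /= fx lexx ltW.
  have [z /= [Hz /andP[mz zd]] zmin] := compact_polyf_min (@compact_band m d) ne pG.
  exists (G z).
    by rewrite lt0r G_ge0 andbT; apply: ncrit => //; rewrite (lt_le_trans m_gt0) // (le_lt_trans zd).
  move=> x Hx; rewrite lt_min => /and3P[fx0 fxd _].
  have cK : compact ([set y | H y = 0 /\ f x <= f y <= d] `&` [set y | G y <= G x]).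
    by apply: compact_closedI; [exact: compact_band|exact: closed_polyf_le pG (polyf_cst _)].
  have ne' : ([set y | H y = 0 /\ f x <= f y <= d] `&` [set y | G y <= G x]) !=set0.
    by exists x; split=> //=; rewrite lexx ltW.
  have [y /= [[Hy /andP[xy yd]] Gy] ymax] := compact_polyf_max cK ne' pf.
  apply: (le_trans _ Gy).
  have [my|ym] := lerP m (f y); first by apply: zmin; split=> //; apply/andP.
  exfalso; have fy0 : 0 < f y by exact: lt_le_trans xy.
  apply: (nmono (f y)); first by rewrite fy0 (lt_trans ym).
  move=> w [Hw [yw wd]].
  have [Gw|Gw] := lerP (G y) (G w); first by exists y.
  have ew : f w = f y.
    apply/eqP; rewrite eq_le yw andbT; apply: ymax; split; last by rewrite (le_trans (ltW Gw)).
    by split=> //; rewrite wd (le_trans xy).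
  by exists w.
pose e := Num.min d d3.
have e_gt0 : 0 < e by rewrite lt_min d_gt0.
(* With [Num.sqrt (G x)] at least [Num.sqrt c], an affine function desingularizes. *)
exists e, (e / Num.sqrt c), (fun u => (e - u) / Num.sqrt c).
have sc : 0 < Num.sqrt c by rewrite sqrtr_gt0.
split=> // [u /andP[u0 ue]|x u Hx u0 ux xe].
  by rewrite divr_ge0 ?subr_ge0 ?(ltW ue) ?(ltW sc) //= ler_pM2r ?invr_gt0 //; lra.
have Gx : c <= G x by apply: hc => //; rewrite (lt_trans u0).
rewrite -mulrBl (_ : e - u - _ = f x - u); last by ring.
rewrite mulrA ler_pdivlMr // mulrC ler_pM2r ?subr_gt0 //.
exact: ler_wsqrtr.
Qed.
End Desingularization.

(** * Convergence of descent sequences *)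

Section DescentConvergence.
Variables (R : realType) (N : nat).
Local Notation V := 'rV[R]_N.

Lemma polyf_cvg (p : V -> R) (x : nat -> V) (z : V) : polyf p ->
  (forall i, x n 0 i @[n --> \oo] --> z 0 i) -> p (x n) @[n --> \oo] --> p z.
Proof.
move=> pp xz; elim: pp => [i|c|q r _ hq _ hr|q r _ hq _ hr].
- exact: xz.
- exact: cvg_cst.
- exact: cvgD hq hr.
- exact: cvgM hq hr.
Qed.

Variables (B C a b : R) (H F G : V -> R) (x : nat -> V).
Hypotheses (pH : polyf H) (pF : polyf F) (pG : polyf G).
Hypothesis H_cube : forall x, H x = 0 -> in_cube B x.
Hypothesis G_ge0 : forall x, 0 <= G x.
Hypotheses (C_gt0 : 0 < C) (a_gt0 : 0 < a) (b_gt0 : 0 < b).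
Hypothesis F_slope : forall x y, H x = 0 -> H y = 0 ->
  `|F x - F y| <= (Num.sqrt (G x) + C * dist1 x y) * dist1 x y.
Local Notation step p := (dist1 (x p.+1) (x p)).
Hypothesis Hx : forall p, H (x p) = 0.
Hypothesis ascent : forall p, F (x p) + a * step p ^+ 2 <= F (x p.+1).
Hypothesis relative_error : forall p, G (x p.+1) <= (b * step p) ^+ 2.

(** Ascent, desingularization and relative error together bound [step p.+1 ^+ 2] by [step p] times
    [b / a] times an increment of [W] along the gaps [f (x p)]; the arithmetic-geometric mean
    inequality makes this linear, and boundedness of [W] bounds the sum. *)
Lemma steps_summable : exists P K, forall n, \sum_(0 <= q < n) step (P + q)%N <= K.
Proof.
have ndF : nondecreasing_seq (fun p => F (x p)).
  apply/nondecreasing_seqP => p; apply: le_trans (ascent p).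
  by rewrite lerDl mulr_ge0 ?sqr_ge0 // ltW.
have [D D0 hD] := polyf_bounded B pF.
have cvF : cvgn (fun p => F (x p)).
  apply: nondecreasing_is_cvgn => //; exists D => _ [p _ <-].
  by rewrite (le_trans (ler_norm _)) // hD //; apply: H_cube.
pose Fs := limn (fun p => F (x p)).
have leFs p : F (x p) <= Fs by exact: nondecreasing_cvgn_le.
pose f v := Fs - F v.
have pf : polyf f by exact: polyfB (polyf_cst _) pF.
have f_slope u v : H u = 0 -> H v = 0 ->
    `|f u - f v| <= (Num.sqrt (G u) + C * dist1 u v) * dist1 u v.
  move=> hu hv; have := F_slope hu hv.
  by rewrite /f (_ : Fs - F u - _ = - (F u - F v)) ?normrN //; ring.
have [d0 [L [W [d0_gt0 Wb hW]]]] := desingularization pH pf pG H_cube G_ge0 C_gt0 f_slope.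
have fx_ge0 p : 0 <= f (x p) by rewrite subr_ge0.
have fdec p : a * step p ^+ 2 <= f (x p) - f (x p.+1) by have := ascent p; rewrite /f; lra.
have step0 p : f (x p) <= f (x p.+1) -> step p = 0.
  move=> h; apply/eqP; rewrite -sqrf_eq0 eq_le sqr_ge0 andbT -(pmulr_rle0 _ a_gt0).
  by have := fdec p; lra.
(* Once the limit value is attained the sequence is stationary; the desingularization only speaks of
   positive gaps. *)
have [[p0 hp0]|npos] := pselect (exists p, f (x p) <= 0).
  have hp p : f (x (p0 + p)%N) <= 0.
    elim: p => [|p IH]; rewrite ?addn0 ?addnS //.
    have := fdec (p0 + p)%N; have : 0 <= a * step (p0 + p)%N ^+ 2 by rewrite mulr_ge0 ?sqr_ge0 // ltW.
    by lra.
  exists p0, 0 => n; rewrite big1_seq // => q _; apply: step0.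
  by rewrite (le_trans (hp q)).
have fx_gt0 p : 0 < f (x p) by rewrite ltNge; apply/negP => h; apply: npos; exists p.
have [P hP] : exists P, forall p, (P <= p)%N -> f (x p) < d0.
  have : F (x p) @[p --> \oo] --> Fs by exact: cvF.
  move/cvgr_dist_lt => /(_ _ d0_gt0) [P _ hP]; exists P => p /hP.
  by rewrite /= ger0_norm ?subr_ge0.
have ba : 0 < b / a by exact: divr_gt0.
pose w p := W (f (x p)).
have wb p : (P <= p)%N -> 0 <= w p <= L by move=> hp; apply: Wb; rewrite fx_gt0 hP.
have key p : (P <= p)%N -> 2 * step p.+1 <= step p + b / a * (w p.+2 - w p.+1).
  move=> hp; have s0 := dist1_ge0 (x p.+1) (x p).
  have [lt|ge] := ltP (f (x p.+2)) (f (x p.+1)); last first.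
    have e0 := step0 _ ge; rewrite e0.
    have -> : w p.+2 = w p.+1.
      congr W; apply/eqP; rewrite eq_le ge andbT.
      by have := fdec p.+1; rewrite e0 expr0n mulr0 subr_ge0.
    by rewrite subrr !mulr0 addr0.
  have := hW _ _ (Hx p.+1) (fx_gt0 p.+2) lt (hP _ (leqW hp)).
  rewrite -/(w p.+1) -/(w p.+2); set v := _ - w p.+1 => hv.
  have sG : Num.sqrt (G (x p.+1)) <= b * step p.
    rewrite -[leRHS]ger0_norm ?mulr_ge0 ?(ltW b_gt0) // -sqrtr_sqr.
    exact: ler_wsqrtr.
  have v0 : 0 < v.
    rewrite ltNge; apply/negP => v0; have := sqrtr_ge0 (G (x p.+1)).
    by move=> g0; have := mulr_ge0_le0 g0 v0; lra.
  have h1 : a * step p.+1 ^+ 2 <= b * step p * v.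
    by apply: (le_trans (fdec _)); apply: (le_trans hv); rewrite ler_pM2r.
  set s1 := step p.+1 in h1 *; set s := step p in s0 h1 *.
  have v1 : 0 <= b / a * v by exact: mulr_ge0 (ltW ba) (ltW v0).
  have h2 : s1 ^+ 2 <= s * (b / a * v).
    rewrite -(ler_pM2l a_gt0); apply: (le_trans h1).
    by rewrite (_ : a * _ = b * s * v) //; field; rewrite lt0r_neq0.
  set e := b / a * v in v1 h2 *; have s1_ge0 : 0 <= s1 by exact: dist1_ge0.
  (* [4 s1^2 <= 4 s e <= (s + e)^2]. *)
  rewrite leNgt; apply/negP => lt2.
  have : (s + e) * (s + e) < (2 * s1) * (2 * s1) by apply: ltr_pM; rewrite ?addr_ge0.
  by have := sqr_ge0 (s - e); move: h2; rewrite !expr2; lra.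
exists P.+1, (step P + b / a * L) => n.
(* The last step is carried on the left so that the next instance of [key] can consume its
   [step p]. *)
suff : \sum_(0 <= q < n) step (P.+1 + q)%N + step (P + n)%N <= step P + b / a * (w (P.+1 + n)%N - w P.+1).
  have := dist1_ge0 (x (P + n).+1) (x (P + n)%N).
  have /andP[_ h1] : 0 <= w (P.+1 + n)%N <= L by apply: wb; rewrite leqW // leq_addr.
  have /andP[h2 _] : 0 <= w P.+1 <= L by apply: wb.
  have : b / a * (w (P.+1 + n)%N - w P.+1) <= b / a * L by rewrite ler_pM2l //; lra.
  by lra.
elim: n => [|n IH]; first by rewrite big_nil !addn0 subrr mulr0 add0r addr0.
rewrite big_nat_recr //=; have := key (P + n)%N (leq_addr _ _).
move: IH; rewrite !addSn !addnS; lra.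
Qed.

Theorem descent_converges : exists z : V,
  [/\ H z = 0, G z = 0 & forall i, x n 0 i @[n --> \oo] --> z 0 i].
Proof.
have [P [K hK]] := steps_summable.
have cv i : cvgn (fun n => x n 0 i).
  suff cvP : cvgn (fun n => x (n + P)%N 0 i).
    apply: (cvgP (limn (fun n => x (n + P)%N 0 i))).
    by rewrite -(cvg_shiftn P).
  pose v n := x (n.+1 + P)%N 0 i - x (n + P)%N 0 i.
  have -> : (fun n => x (n + P)%N 0 i) = (fun n => x P 0 i + series v n).
    by apply/funext => n; rewrite /series /= telescope_sumr // add0n; ring.
  apply: is_cvgD; first exact: is_cvg_cst.
  apply: normed_cvg; apply: nondecreasing_is_cvgn.
    by apply: nondecreasing_series => n _ _; exact: normr_ge0.
  exists K => _ [n _ <-]; apply: le_trans (hK n); rewrite /series /=.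
  by apply: ler_sum => q _; rewrite /v addSn [(q + P)%N]addnC; exact: coord_le_dist1.
pose z : V := \row_i limn (fun n => x n 0 i).
have xz i : x n 0 i @[n --> \oo] --> z 0 i by rewrite mxE; exact: cv.
exists z; split=> //.
  have h0 : H (x n) @[n --> \oo] --> (0 : R) by under eq_fun do rewrite Hx; exact: cvg_cst.
  by rewrite -(cvg_lim (@Rhausdorff R) (polyf_cvg pH xz)) (cvg_lim (@Rhausdorff R) h0).
apply/eqP; rewrite eq_le G_ge0 andbT.
have xz1 i : x n.+1 0 i @[n --> \oo] --> z 0 i by rewrite (cvg_shiftS (fun n => x n 0 i)).
(* Relative error followed by ascent bounds [G (x n.+1)] by this multiple of the increment of
   [F]. *)
have hl : b ^+ 2 / a * (F (x n.+1) - F (x n)) @[n --> \oo] --> b ^+ 2 / a * (F z - F z).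
  by apply: cvgM (cvg_cst _) _; apply: cvgB; [exact: polyf_cvg pF xz1|exact: polyf_cvg pF xz].
rewrite -(mulr0 (b ^+ 2 / a)) -(subrr (F z)).
apply: ler_cvg_to (polyf_cvg pG xz1) hl _; near=> n.
apply: (le_trans (relative_error n)); rewrite exprMn -mulrA ler_pM2l ?exprn_gt0 //.
by rewrite ler_pdivlMl //; have := ascent n; lra.
Unshelve. all: by end_near.
Qed.
End DescentConvergence.

(** * Polar factors *)

Section Blocks.
Variables (R : realType) (m : nat).
Implicit Types (u v w : 'I_m -> R).

Lemma dotC u v : dot u v = dot v u.
Proof. by apply: eq_bigr => c _; rewrite mulrC. Qed.

Lemma dotBr u v w : dot u (fun c => v c - w c) = dot u v - dot u w.
Proof. by rewrite /dot -sumrB; apply: eq_bigr => c _; rewrite mulrBr. Qed.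

Lemma dotBl u v w : dot (fun c => v c - w c) u = dot v u - dot w u.
Proof. by rewrite dotC dotBr !(dotC u). Qed.

Lemma dot_lin u v w (a b : R) : dot (fun c => a * u c + b * v c) w = a * dot u w + b * dot v w.
Proof. by rewrite /dot !mulr_sumr -big_split; apply: eq_bigr => c _; rewrite mulrDl !mulrA. Qed.

Lemma dot_linr u v w (a b : R) : dot w (fun c => a * u c + b * v c) = a * dot w u + b * dot w v.
Proof. by rewrite dotC dot_lin !(dotC w). Qed.

Lemma dot_suml (t : nat) (q : nat -> 'I_m -> R) (s : nat -> R) v :
  dot (fun c => \sum_(a < t) q a c * s a) v = \sum_(a < t) s a * dot (q a) v.
Proof.
rewrite /dot; under eq_bigr do rewrite mulr_suml.
rewrite exchange_big; apply: eq_bigr => a _; rewrite mulr_sumr.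
by apply: eq_bigr => c _; ring.
Qed.

Lemma dot_ge0 u : 0 <= dot u u.
Proof. by apply: sumr_ge0 => c _; rewrite -expr2 sqr_ge0. Qed.

Lemma dot_eq0 u : dot u u = 0 -> forall c, u c = 0.
Proof.
move=> /eqP; rewrite psumr_eq0 => [/allP h c|c _]; last by rewrite -expr2 sqr_ge0.
by have := h c (mem_index_enum c); rewrite mulf_eq0 orbb => /eqP.
Qed.

Lemma cauchy_schwarz u v : dot u v ^+ 2 <= dot u u * dot v v.
Proof.
have [v0|vn] := eqVneq (dot v v) 0.
  rewrite v0 mulr0 (_ : dot u v = 0) ?expr0n //.
  by rewrite /dot big1 // => c _; rewrite (dot_eq0 v0) mulr0.
have vp : 0 < dot v v by rewrite lt0r vn dot_ge0.
have := dot_ge0 (fun c => dot v v * u c + (- dot u v) * v c).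
rewrite dot_lin !dot_linr (dotC v u) => h.
have {}h : 0 <= dot v v * (dot v v * dot u u - dot u v ^+ 2) by move: h; rewrite expr2; lra.
by move: h; rewrite pmulr_rge0 // subr_ge0 mulrC.
Qed.

(* u and y have Gram matrices that agree where S is nonzero, so the first variation in the direction
   y - u is of second order. *)
Lemma block_identity (t : nat) (S : nat -> nat -> R) (u y : nat -> 'I_m -> R) :
  (forall a j, (a < t)%N -> (j < t)%N -> S a j = S j a) ->
  (forall a j, (a < t)%N -> (j < t)%N -> S a j * (dot (y a) (y j) - dot (u a) (u j)) = 0) ->
  \sum_(j < t) dot (fun c => \sum_(a < t) u a c * S a j) (fun c => y j c - u j c) =
  - (\sum_(a < t) \sum_(j < t) S a j * dot (fun c => y a c - u a c) (fun c => y j c - u j c)) / 2.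
Proof.
move=> symS hS.
pose p a j := dot (u a) (y j).
have swap : \sum_(a < t) \sum_(j < t) S a j * p j a = \sum_(a < t) \sum_(j < t) S a j * p a j.
  by rewrite exchange_big; do 2!apply: eq_bigr => ? _; rewrite symS.
have -> : \sum_(j < t) dot (fun c => \sum_(a < t) u a c * S a j) (fun c => y j c - u j c) =
    \sum_(a < t) \sum_(j < t) S a j * p a j - \sum_(a < t) \sum_(j < t) S a j * dot (u a) (u j).
  rewrite -sumrB; under [RHS]eq_bigr do rewrite -sumrB.
  rewrite [RHS]exchange_big /=; apply: eq_bigr => j _.
  rewrite (dot_suml t u (S^~ j)); apply: eq_bigr => a _.
  by rewrite dotBr mulrBr.
rewrite (_ : \sum_(a < t) \sum_(j < t) S a j * dot (fun c => y a c - u a c) (fun c => y j c - u j c) =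
   \sum_(a < t) \sum_(j < t) S a j * dot (u a) (u j) * 2 -
   \sum_(a < t) \sum_(j < t) S a j * p a j - \sum_(a < t) \sum_(j < t) S a j * p j a); last first.
  rewrite -!sumrB; apply: eq_bigr => a _; rewrite -!sumrB; apply: eq_bigr => j _.
  have := hS a j (ltn_ord a) (ltn_ord j).
  by rewrite /p dotBl !dotBr (dotC (y a) (u j)); lra.
rewrite swap.
have -> : \sum_(a < t) \sum_(j < t) S a j * dot (u a) (u j) * 2 =
  (\sum_(a < t) \sum_(j < t) S a j * dot (u a) (u j)) * 2.
  by rewrite mulr_suml; apply: eq_bigr => a _; rewrite mulr_suml.
by field.
Qed.

(** Takes the place of differentiation at an extremum, for the polar factors and for the Rayleigh
    quotient. The value tested is [beta / (|alpha| + 1)]. *)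
Lemma linear_le_quadratic_eq0 (alpha beta : R) :
  (forall h, h * beta <= h ^+ 2 * alpha) -> beta = 0.
Proof.
move=> hb; pose A := `|alpha| + 1.
have A0 : 0 < A by rewrite ltr_wpDl.
have le : alpha + 1 <= A by rewrite lerD2r ler_norm.
pose g := beta / A; have gA : beta = g * A by rewrite /g mulfVK ?lt0r_neq0.
have h : g ^+ 2 * (A - alpha) <= 0.
  by have := hb g; rewrite [in X in X -> _]gA; rewrite (_ : g * (g * A) = g ^+ 2 * A); [lra|ring].
have : g ^+ 2 <= 0 by have := sqr_ge0 g; nra.
by move=> ?; rewrite gA (_ : g = 0) ?mul0r //; apply/eqP;
  rewrite -sqrf_eq0 eq_le sqr_ge0 andbT.
Qed.

(** Symmetry of [Q^T X] is the first-order condition for rotations of columns [j] and [l] in their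
    own plane. *)
Lemma polar_rotate (t : nat) (X Q : nat -> 'I_m -> R) j l : polar t X Q ->
  (j < t)%N -> (l < t)%N -> dot (Q j) (X l) = dot (Q l) (X j).
Proof.
move=> [oQ maxQ] jt lt; have [->//|jl] := eqVneq j l.
have lj : (l == j) = false by rewrite eq_sym; exact: negbTE.
apply/eqP; rewrite -subr_eq0; apply/eqP.
apply: (@linear_le_quadratic_eq0 (dot (Q j) (X j) + dot (Q l) (X l))) => h.
have d0 : 0 < 1 + h ^+ 2 by rewrite ltr_wpDr ?sqr_ge0.
(* (c, s) is a rational point of the unit circle *)
pose c := (1 - h ^+ 2) / (1 + h ^+ 2); pose s := 2 * h / (1 + h ^+ 2).
have cs : c * c + s * s = 1 by rewrite /c /s; field; rewrite lt0r_neq0.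
pose Q' i : 'I_m -> R := if i == j then (fun x => c * Q j x + (- s) * Q l x)
  else if i == l then (fun x => s * Q j x + c * Q l x) else Q i.
have oQ' : orthonormal t Q'.
  move=> i i' it i't; rewrite /Q'.
  case: (i =P j) => [->|/eqP ij]; case: (i' =P j) => [->|/eqP i'j];
    rewrite ?(dot_lin, dot_linr) ?(eq_sym j).
  - by rewrite !oQ // !eqxx (negbTE jl) lj /= ; lra.
  - case: (i' =P l) => [->|/eqP i'l].
      by rewrite ?(dot_lin, dot_linr) !oQ // !eqxx lj (negbTE jl) /=; lra.
    by rewrite !oQ // !(eq_sym _ i') (negbTE i'j) (negbTE i'l) /= !mulr0 addr0.
  - case: (i =P l) => [->|/eqP il].
      by rewrite ?(dot_lin, dot_linr) !oQ // !eqxx lj (negbTE jl) /=; lra.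
    by rewrite !oQ // (negbTE ij) (negbTE il) /= !mulr0 addr0.
  case: (i =P l) => [->|/eqP il]; case: (i' =P l) => [->|/eqP i'l];
    rewrite ?(dot_lin, dot_linr) !oQ // ?eqxx ?lj ?(negbTE jl) ?(eq_sym _ i') ?(negbTE i'j) ?(negbTE i'l) ?(negbTE ij) ?(negbTE il) /=; lra.
have := maxQ Q' oQ'; rewrite /inner.
rewrite (bigD1 (Ordinal jt)) //= (bigD1 (Ordinal lt)) /=; last by rewrite -val_eqE /= lj.
rewrite [leRHS](bigD1 (Ordinal jt)) //= [X in _ <= _ + X](bigD1 (Ordinal lt)) /=; last by rewrite -val_eqE /= lj.
rewrite (eq_bigr (fun i : 'I_t => dot (Q i) (X i))); last first.
  by move=> i /andP[ij il]; rewrite /Q' !ifF //; apply: negbTE.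
rewrite !addrA lerD2r /Q' !eqxx lj !dot_lin => hh.
have {hh} : (c - 1) * (dot (Q j) (X j) + dot (Q l) (X l)) - s * (dot (Q l) (X j) - dot (Q j) (X l)) <= 0 by lra.
have -> : (c - 1) * (dot (Q j) (X j) + dot (Q l) (X l)) - s * (dot (Q l) (X j) - dot (Q j) (X l)) =
   2 * (h * (dot (Q j) (X l) - dot (Q l) (X j)) - h ^+ 2 * (dot (Q j) (X j) + dot (Q l) (X l))) / (1 + h ^+ 2).
  by rewrite /c /s; field; rewrite lt0r_neq0.
by rewrite pmulr_lle0 ?invr_gt0 // pmulr_rle0 // subr_le0.
Qed.

(** The defect [w] of [X j] is orthogonal to every column of [Q], so column [j] may be turned
    towards it without losing orthonormality; maximality forces [w = 0]. With the symmetry of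
    [Q^T X] this yields [X = Q S] without singular values. *)
Lemma polar_span (t : nat) (X Q : nat -> 'I_m -> R) j : polar t X Q -> (j < t)%N ->
  forall x, X j x = \sum_(a < t) Q a x * dot (Q a) (X j).
Proof.
move=> [oQ maxQ] jt x.
pose pr x := \sum_(a < t) Q a x * dot (Q a) (X j).
pose w x := X j x - pr x.
have wQ i : (i < t)%N -> dot w (Q i) = 0.
  move=> it; rewrite dotBl (dot_suml t Q (fun a => dot (Q a) (X j))).
  rewrite (bigD1 (Ordinal it)) //= big1 => [|a ai].
    by rewrite oQ // eqxx mulr1 addr0 dotC subrr.
  by rewrite oQ // (_ : (a == i :> nat) = false) ?mulr0 //; apply: negbTE.
have wX : dot w (X j) = dot w w.
  have -> : dot w w = dot w (X j) - dot w pr by rewrite -dotBr.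
  rewrite (dotC w pr) (dot_suml t Q (fun a => dot (Q a) (X j))).
  by rewrite big1 ?subr0 // => a _; rewrite (dotC _ w) wQ ?mulr0.
suff w0 : dot w w = 0 by apply/eqP; rewrite -subr_eq0; apply/eqP; exact: (dot_eq0 w0 x).
apply: (@linear_le_quadratic_eq0 (dot w w * dot (Q j) (X j))) => h.
set nu := dot w w in wX *; have nu0 : 0 <= nu by exact: dot_ge0.
have d0 : 0 < 1 + h ^+ 2 * nu by have := mulr_ge0 (sqr_ge0 h) nu0; lra.
(* [w] has squared norm [nu], so the unit circle becomes the ellipse [c^2 + nu s^2 = 1], again
   parametrized rationally. *)
pose c := (1 - h ^+ 2 * nu) / (1 + h ^+ 2 * nu); pose s := 2 * h / (1 + h ^+ 2 * nu).
have cs : c * c + s * s * nu = 1 by rewrite /c /s; field; rewrite lt0r_neq0.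
pose Q' i : 'I_m -> R := if i == j then (fun x => c * Q j x + s * w x) else Q i.
have oQ' : orthonormal t Q'.
  move=> i i' it i't; rewrite /Q'.
  case: (i =P j) => [->|/eqP ij]; case: (i' =P j) => [->|/eqP i'j];
    rewrite ?(dot_lin, dot_linr) ?oQ ?wQ ?(dotC _ w) ?wQ // ?eqxx -/nu ?mulr0 ?addr0 ?mulr1.
  - by rewrite add0r /=; lra.
  - by rewrite eq_sym (negbTE i'j) mulr0.
  - by rewrite (negbTE ij) mulr0.
have := maxQ Q' oQ'; rewrite /inner.
rewrite (bigD1 (Ordinal jt)) //= [leRHS](bigD1 (Ordinal jt)) //=.
rewrite (eq_bigr (fun i : 'I_t => dot (Q i) (X i))); last first.
  by move=> i ij; rewrite /Q' ifF //; apply: negbTE.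
rewrite lerD2r /Q' eqxx dot_lin wX => hh.
have {hh} : (c - 1) * dot (Q j) (X j) + s * nu <= 0 by lra.
have -> : (c - 1) * dot (Q j) (X j) + s * nu =
   2 * (h * nu - h ^+ 2 * (nu * dot (Q j) (X j))) / (1 + h ^+ 2 * nu).
  by rewrite /c /s; field; rewrite lt0r_neq0.
by rewrite pmulr_lle0 ?invr_gt0 // pmulr_rle0 // subr_le0.
Qed.
End Blocks.

(** * The least eigenvalue as minimum of the Rayleigh quotient *)

Section Rayleigh.
Variables (R : realType) (t : nat) (S : 'M[R]_t) (eps : R).
Hypothesis symS : S^T = S.

(** A minimizer of the form on the unit sphere is an eigenvector and its value [mu] an eigenvalue,
    so [eps <= mu]. *)
Lemma quadratic_form_lower_bound : ~ min_eig_lt S eps -> forall z : 'rV[R]_t,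
  eps * \sum_i z 0 i ^+ 2 <= \sum_i \sum_j S i j * (z 0 i * z 0 j).
Proof.
move=> neig z.
pose n2 (z : 'rV[R]_t) := \sum_i z 0 i ^+ 2.
pose q (z : 'rV[R]_t) := \sum_i \sum_j S i j * (z 0 i * z 0 j).
rewrite -/(n2 z) -/(q z).
have pn2 : polyf n2 by apply: polyf_sum => i _; exact: polyfM (polyf_var i) (polyf_var i).
have pq : polyf q.
  apply: polyf_sum => i _; apply: polyf_sum => j _.
  by apply: polyfM (polyf_cst _) _; exact: polyfM (polyf_var i) (polyf_var j).
have n2_ge0 u : 0 <= n2 u by apply: sumr_ge0 => i _; exact: sqr_ge0.
have n2Z a u : n2 (a *: u) = a ^+ 2 * n2 u.
  by rewrite /n2 mulr_sumr; apply: eq_bigr => i _; rewrite mxE exprMn.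
have qZ a u : q (a *: u) = a ^+ 2 * q u.
  rewrite /q mulr_sumr; apply: eq_bigr => i _; rewrite mulr_sumr; apply: eq_bigr => j _.
  by rewrite !mxE; ring.
have n2_eq0 u : n2 u = 0 -> u = 0.
  move=> /eqP; rewrite psumr_eq0 => [/allP h|i _]; last exact: sqr_ge0.
  apply/rowP => i; rewrite mxE; apply/eqP; rewrite -sqrf_eq0.
  exact: h i (mem_index_enum i).
have qE u : q u = (u *m S *m u^T) 0 0.
  rewrite /q mxE exchange_big; apply: eq_bigr => j _; rewrite !mxE mulr_suml.
  by apply: eq_bigr => i _; ring.
have n2E u : n2 u = (u *m u^T) 0 0.
  by rewrite /n2 mxE; apply: eq_bigr => j _; rewrite !mxE expr2.
have [z0|zn0] := eqVneq (n2 z) 0.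
  rewrite z0 mulr0 (n2_eq0 _ z0) (_ : q 0 = 0) //.
  by rewrite /q big1 // => i _; rewrite big1 // => j _; rewrite !mxE !mul0r mulr0.
have normalize u : n2 u != 0 -> n2 ((Num.sqrt (n2 u))^-1 *: u) = 1.
  by move=> u0; rewrite n2Z exprVn sqr_sqrtr // mulVf.
have cK : compact [set u | n2 u = 1].
  have -> : [set u | n2 u = 1] =
      [set u | in_cube 1 u] `&` ([set u | n2 u <= 1] `&` [set u | 1 <= n2 u]).
    apply/seteqP; split=> u /=; last by move=> [_ [h1 h2]]; apply/eqP; rewrite eq_le h1.
    move=> h; split; last by rewrite h lexx.
    move=> i; rewrite -(@ler_pXn2r _ 2) ?nnegrE // expr1n real_normK ?num_real // -h.
    by rewrite /n2 (bigD1 i) //= lerDl sumr_ge0 // => j _; exact: sqr_ge0.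
  apply: compact_closedI; [exact: compact_cube|apply: closedI].
    exact: closed_polyf_le pn2 (polyf_cst _).
  exact: closed_polyf_le (polyf_cst _) pn2.
have [|z0 /= z01 minz0] := compact_polyf_min cK _ pq.
  by exists ((Num.sqrt (n2 z))^-1 *: z); exact: normalize.
set mu := q z0 in minz0.
have mu_le u : mu * n2 u <= q u.
  have [u0|un0] := eqVneq (n2 u) 0.
    by rewrite u0 mulr0 (n2_eq0 _ u0) /q big1 // => i _; rewrite big1 // => j _; rewrite !mxE !mul0r mulr0.
  have := minz0 _ (normalize u un0); rewrite qZ exprVn sqr_sqrtr //.
  by rewrite ler_pdivlMl ?lt0r ?un0 ?n2_ge0 // mulrC.
suff eig : z0 *m S = mu *: z0.
  have : eps <= mu.
    rewrite leNgt; apply/negP => lt; apply: neig; exists mu => //.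
    apply/eigenvalueP; exists z0 => //; apply/eqP => z00.
    by move: z01; rewrite z00 /n2 big1 => [/eqP|i _]; rewrite ?mxE ?expr0n //= eq_sym oner_eq0.
  by move=> h; apply: le_trans (mu_le z); rewrite ler_wpM2r.
pose T := S - mu%:M.
have symT : T^T = T by rewrite /T linearB /= symS tr_scalar_mx.
have tqE u : (u *m T *m u^T) 0 0 = q u - mu * n2 u.
  by rewrite /T mulmxBr mulmxBl mul_mx_scalar -scalemxAl qE n2E !mxE.
pose v := z0 *m T.
suff v0 : v = 0.
  by apply/eqP; rewrite -subr_eq0 -mul_mx_scalar -mulmxBr -/T -/v v0.
(* The form of [T] is nonnegative and vanishes at [z0]; its expansion at [z0 - h v] has linear term
   [- 2 h |v|^2]. *)
apply: n2_eq0; apply: (@linear_le_quadratic_eq0 _ ((v *m T *m v^T) 0 0 / 2)) => h.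
have : 0 <= ((z0 - h *: v) *m T *m (z0 - h *: v)^T) 0 0 by rewrite tqE subr_ge0.
have vT : v *m T *m z0^T = v *m v^T by rewrite /v trmx_mul symT mulmxA.
have zT : z0 *m T *m v^T = v *m v^T by [].
have z00 : (z0 *m T *m z0^T) 0 0 = 0 by rewrite tqE z01 /mu mulr1 subrr.
clearbody v T.
have -> : (z0 - h *: v) *m T *m (z0 - h *: v)^T =
    z0 *m T *m z0^T - (2 * h) *: (v *m v^T) + h ^+ 2 *: (v *m T *m v^T).
  have -> : (z0 - h *: v)^T = z0^T - h *: v^T by apply/matrixP => i j; rewrite !mxE.
  rewrite !(mulmxBl, mulmxBr) -!scalemxAr -!scalemxAl.
  by rewrite vT zT !scalerA -expr2 mulr_natl mulr2n scalerDl opprB opprD !addrA addrAC.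
have entry (X Y Z : 'M[R]_1) c d : (X - c *: Y + d *: Z) 0 0 = X 0 0 - c * Y 0 0 + d * Z 0 0.
  by rewrite !mxE.
by rewrite entry z00 -n2E; lra.
Qed.
End Rayleigh.

(** * Block updates *)

Section AlsUpdate.
Variables (R : realType) (m : nat).
Implicit Types u w : 'I_m -> R.

Lemma dotZl (c : R) u w : dot (fun a => c * u a) w = c * dot u w.
Proof. by rewrite /dot mulr_sumr; apply: eq_bigr => a _; rewrite mulrA. Qed.

(** With [l = |dot u w|] and [nu] the norm of [w], the gain is [(nu - l)(nu + l)] and the squared
    displacement [2 (nu - l) / nu]. Their ratio [nu (nu + l) / 2] is at least [kappa ^+ 2], as
    [kappa <= l <= nu] by Cauchy-Schwarz. *)
Lemma als_update (kappa : R) u w : 0 < kappa -> dot u u = 1 -> kappa <= `|dot u w| ->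
  let u' := (fun a => Num.sg (dot u w) / vnorm w * w a) in
  [/\ dot u' u' = 1, `|dot u w| <= `|dot u' w|,
      kappa ^+ 2 * dot (fun a => u' a - u a) (fun a => u' a - u a) <= dot u' w ^+ 2 - dot u w ^+ 2 &
      exists p, forall a, w a * dot u w = u' a * p].
Proof.
move=> k0 u1 kl u'; set lam := dot u w in kl *.
have l0 : lam != 0 by rewrite -normr_gt0 (lt_le_trans k0).
set nu := vnorm w in u' *.
have nu2 : nu ^+ 2 = dot w w by rewrite /nu /vnorm sqr_sqrtr // dot_ge0.
have lnu : `|lam| <= nu.
  rewrite -(@ler_pXn2r _ 2) ?nnegrE ?sqrtr_ge0 // real_normK ?num_real // nu2.
  by have := cauchy_schwarz u w; rewrite u1 mul1r.
have knu : kappa <= nu by exact: le_trans lnu.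
have nu0 : 0 < nu by exact: lt_le_trans knu.
have sg2 : Num.sg lam * Num.sg lam = 1 by rewrite -expr2 sqr_sg l0.
have sgl : Num.sg lam * lam = `|lam| by rewrite normrEsg.
have u'w : dot u' w = Num.sg lam * nu.
  by rewrite dotZl -nu2; field; rewrite lt0r_neq0.
have u'u' : dot u' u' = 1.
  have -> : dot u' u' = Num.sg lam / nu * dot u' w by rewrite [LHS]dotZl (dotC w).
  rewrite u'w -sg2; by field; rewrite lt0r_neq0.
have u'u : dot u' u = `|lam| / nu by rewrite dotZl (dotC w) -/lam -sgl; ring.
split=> //.
- by rewrite u'w normrM normr_sg l0 mul1r (gtr0_norm nu0).
- rewrite dotBl !dotBr u'u' u1 (dotC u) u'u u'w exprMn sqr_sg l0 mul1r -[lam ^+ 2](real_normK (num_real lam)).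
  have -> : 1 - `|lam| / nu - (`|lam| / nu - 1) = 2 * (nu - `|lam|) / nu by field; rewrite lt0r_neq0.
  rewrite mulrA ler_pdivrMr //.
  set l := `|lam| in kl lnu *.
  have h : kappa ^+ 2 * 2 <= (nu + l) * nu.
    by rewrite expr2; have := ler_pM (ltW k0) (ltW k0) knu kl; have := ler_pM (ltW k0) (ltW k0) knu knu; lra.
  have := mulr_ge0 (_ : 0 <= nu - l) (_ : 0 <= (nu + l) * nu - kappa ^+ 2 * 2).
  by rewrite !subr_ge0 => /(_ lnu h); lra.
- exists (Num.sg lam * nu * lam) => a; rewrite /u'.
  have -> : Num.sg lam / nu * w a * (Num.sg lam * nu * lam) = (Num.sg lam * Num.sg lam) * (w a * lam) by field; rewrite lt0r_neq0.
  by rewrite sg2 mul1r.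
Qed.
End AlsUpdate.

(** * The objective under a change of one block *)

Section TensorCalculus.
Variables (R : realType) (k : nat) (n : 'I_k -> nat) (A : @tensor R k n).

Lemma tau_dot (x : @vfam R k n) i : tau n A x = dot (x i) (tau_i n A i x).
Proof.
rewrite /tau (partition_big (fun idx : mindex n => idx i) xpredT) //=.
apply: eq_bigr => a _; rewrite /tau_i mulr_sumr; apply: eq_bigr => idx /eqP ia.
by rewrite (bigD1 i) //= ia; ring.
Qed.

Lemma eq_tau_i (x y : @vfam R k n) i : (forall l, l != i -> x l = y l) -> tau_i n A i x = tau_i n A i y.
Proof.
move=> xy; apply/funext => a; apply: eq_bigr => idx _; congr (_ * _).
by apply: eq_bigr => l li; rewrite xy.
Qed.

Lemma eq_tau (x y : @vfam R k n) : (forall l, x l = y l) -> tau n A x = tau n A y.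
Proof. by move=> xy; apply: eq_bigr => idx _; congr (_ * _); apply: eq_bigr => l _; rewrite xy. Qed.

(** Unlike in [mix], the index is a natural number and can reach [k], so that a sweep telescopes
    from the old iterate to the new one. *)
Definition mixn (m : nat) (Unew Uold : @iterate R k n) : @iterate R k n :=
  fun l j => if (l < m)%N then Unew l j else Uold l j.

(** Half the partial gradient of [fobj], that is, the entry of [V Lambda] in the KKT condition. *)
Definition grad (U : @iterate R k n) (i : 'I_k) (j : nat) (a : 'I_(n i)) : R :=
  tau_i n A i (colsof n U j) a * lam n A U j.

Definition delta (U1 U0 : @iterate R k n) (i : 'I_k) (j : nat) (a : 'I_(n i)) : R := U1 i j a - U0 i j a.

Arguments grad : clear implicits.
Arguments delta : clear implicits.

Lemma lam_mix_new U1 U0 (i : 'I_k) j :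
  lam n A (mixn i.+1 U1 U0) j = dot (U1 i j) (tau_i n A i (colsof n (mixn i U1 U0) j)).
Proof.
rewrite /lam (tau_dot _ i) /colsof {1}/mixn ltnSn; congr dot; apply: eq_tau_i => l li.
by rewrite /mixn ltnS leq_eqVlt val_eqE (negbTE li).
Qed.

Lemma lam_mix_old U1 U0 (i : 'I_k) j :
  lam n A (mixn i U1 U0) j = dot (U0 i j) (tau_i n A i (colsof n (mixn i U1 U0) j)).
Proof. by rewrite /lam (tau_dot _ i) /colsof {1}/mixn ltnn. Qed.

(** Each [lam] is linear in a single block, so the expansion of its square is exact. The second sum
    is nonnegative, hence ascent only requires a bound on the linear term. *)
Lemma fobj_block_gain t U1 U0 (i : 'I_k) :
  fobj n A t (mixn i.+1 U1 U0) - fobj n A t (mixn i U1 U0) =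
  2 * \sum_(j < t) dot (grad (mixn i U1 U0) i j) (delta U1 U0 i j) +
  \sum_(j < t) dot (tau_i n A i (colsof n (mixn i U1 U0) j)) (delta U1 U0 i j) ^+ 2.
Proof.
rewrite /fobj -sumrB mulr_sumr -big_split /=; apply: eq_bigr => j _.
have gE : dot (grad (mixn i U1 U0) i j) (delta U1 U0 i j) =
    lam n A (mixn i U1 U0) j * dot (tau_i n A i (colsof n (mixn i U1 U0) j)) (delta U1 U0 i j).
  by rewrite -dotZl; apply: eq_bigr => a _; rewrite /grad; ring.
by rewrite gE /delta dotBr !(dotC (tau_i _ _ _ _)) -lam_mix_new -lam_mix_old; ring.
Qed.

Lemma fobj_telescope t (U1 U0 : @iterate R k n) :
  fobj n A t U1 - fobj n A t U0 =
  \sum_(i < k) (fobj n A t (mixn i.+1 U1 U0) - fobj n A t (mixn i U1 U0)).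
Proof.
rewrite -(big_mkord xpredT (fun i => fobj n A t (mixn i.+1 U1 U0) - fobj n A t (mixn i U1 U0))).
rewrite telescope_sumr //; congr (_ - _); apply: eq_bigr => j _; congr (_ ^+ 2).
by apply: eq_tau => l; rewrite /colsof /mixn ltn_ord.
Qed.

(* One block of a sweep: the new block carries the multiplier S up to a proximal error,
   and the objective grows quadratically in the displacement. *)
Definition block_update (s t : nat) (eps c : R) (U1 U0 : @iterate R k n) (i : 'I_k) : Prop :=
  (exists S : nat -> nat -> R, [/\ forall a j, (a < t)%N -> (j < t)%N -> S a j = S j a,
     forall a j, (a < t)%N -> (j < t)%N -> (s <= i)%N -> a != j -> S a j = 0 &
     forall j x, (j < t)%N -> `|grad (mixn i U1 U0) i j x - \sum_(a < t) U1 i a x * S a j|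
        <= eps * `|delta U1 U0 i j x|]) /\
  c * \sum_(j < t) dot (delta U1 U0 i j) (delta U1 U0 i j) <=
    fobj n A t (mixn i.+1 U1 U0) - fobj n A t (mixn i U1 U0).

(** Both branches make the linear term at least [eps / 2] times the squared displacement. Without
    correction, [block_identity] at the new block turns it into half the form of [S], whose
    eigenvalues are at least [eps]; with correction, it suffices to compare the maximizer with [U0]
    itself. *)
Lemma polar_block_update s t eps U1 U0 (i : 'I_k) Q0 :
  0 < eps -> (i < s)%N -> orthonormal t (U0 i) -> let X := grad (mixn i U1 U0) i in
  polar t X Q0 ->
  (~ min_eig_lt (Smat t Q0 X) eps /\ forall j, (j < t)%N -> U1 i j = Q0 j) \/
  polar t (fun j a => X j a + eps * U0 i j a) (U1 i) ->
  block_update s t eps eps U1 U0 i.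
Proof.
move=> e0 i_s oU X pol cases.
have gain : eps / 2 * \sum_(j < t) dot (delta U1 U0 i j) (delta U1 U0 i j) <=
     \sum_(j < t) dot (X j) (delta U1 U0 i j) ->
   eps * \sum_(j < t) dot (delta U1 U0 i j) (delta U1 U0 i j) <=
    fobj n A t (mixn i.+1 U1 U0) - fobj n A t (mixn i U1 U0).
  rewrite fobj_block_gain -/X => h.
  have : 0 <= \sum_(j < t) dot (tau_i n A i (colsof n (mixn i U1 U0) j)) (delta U1 U0 i j) ^+ 2.
    by apply: sumr_ge0 => j _; exact: sqr_ge0.
  by lra.
case: cases => [[neig UQ]|polU].
- pose S a j := dot (Q0 a) (X j).
  have symS a j : (a < t)%N -> (j < t)%N -> S a j = S j a by exact: polar_rotate.
  have XE j : (j < t)%N -> X j = fun x => \sum_(a < t) U1 i a x * S a j.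
    move=> jt; apply/funext => x; rewrite (polar_span pol jt).
    by apply: eq_bigr => a _; rewrite UQ.
  have oQ : orthonormal t (U1 i) by move=> a j at_ jt; rewrite !UQ //; exact: pol.1.
  split.
    exists S; split=> [||j x jt]; first exact: symS.
      by move=> a j _ _; rewrite leqNgt i_s.
    by rewrite -/X XE // subrr normr0 mulr_ge0 // ltW.
  apply: gain; rewrite [leRHS](eq_bigr (fun j : 'I_t => - dot (fun x => \sum_(a < t) U1 i a x * S a j)
       (fun x => U0 i j x - U1 i j x))); last first.
    move=> j _; rewrite -XE // /delta !dotBr; ring.
  rewrite sumrN block_identity //; last first.
    by move=> a j at_ jt; rewrite oU // oQ // subrr mulr0.
  rewrite mulNr opprK mulrAC ler_pM2r ?invr_gt0 //.
  have symM : (Smat t Q0 X)^T = Smat t Q0 X.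
    by apply/matrixP => a j; rewrite !mxE; exact: symS.
  (* The eigenvalue bound is applied to each row of the displacement matrix and summed over the
     rows. *)
  pose z x : 'rV[R]_t := \row_j delta U1 U0 i j x.
  have : \sum_x eps * (\sum_(j < t) z x 0 j ^+ 2) <=
      \sum_x \sum_(a < t) \sum_(j < t) Smat t Q0 X a j * (z x 0 a * z x 0 j).
    by apply: ler_sum => x _; exact: quadratic_form_lower_bound symM neig (z x).
  rewrite -mulr_sumr.
  congr (_ <= _).
    congr (_ * _); rewrite exchange_big; apply: eq_bigr => j _; apply: eq_bigr => x _.
    by rewrite mxE expr2.
  rewrite exchange_big; apply: eq_bigr => a _; rewrite exchange_big; apply: eq_bigr => j _.
  rewrite /dot mulr_sumr; apply: eq_bigr => x _; rewrite !mxE /delta /S; ring.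
- pose Y j a := X j a + eps * U0 i j a.
  (* Removing [eps] times the identity leaves the error [X - U1 S = eps (U1 - U0)], which vanishes
     with the displacement. *)
  pose S a j := dot (U1 i a) (Y j) - eps * (a == j)%:R.
  have oU1 := polU.1.
  split.
    exists S; split=> [a j at_ jt||j x jt].
    - by rewrite /S (polar_rotate polU at_ jt) eq_sym.
    - by move=> a j _ _; rewrite leqNgt i_s.
    have -> : \sum_(a < t) U1 i a x * S a j = Y j x - eps * U1 i j x.
      have -> : Y j x = \sum_(a < t) U1 i a x * dot (U1 i a) (Y j) by exact: polar_span polU jt x.
      rewrite (eq_bigr (fun a : 'I_t => U1 i a x * dot (U1 i a) (Y j) - eps * (U1 i a x * ((a == j :> nat)%:R)))); last first.
        by move=> a _; rewrite /S; ring.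
      rewrite sumrB -mulr_sumr; congr (_ - _ * _).
      rewrite (bigD1 (Ordinal jt)) //= eqxx mulr1 big1 ?addr0 // => a aj.
      by rewrite (_ : (a == j :> nat) = false) ?mulr0 //; apply: negbTE.
    rewrite -/X /Y (_ : _ - _ = eps * delta U1 U0 i j x); last by rewrite /delta; ring.
    by rewrite normrM (gtr0_norm e0).
  apply: gain.
  have := polU.2 _ oU; rewrite /inner => h.
  rewrite mulr_sumr -subr_ge0 -sumrB.
  move: h; rewrite -subr_ge0 -sumrB; congr (0 <= _); apply: eq_bigr => j _.
  have Ydot u : dot u (fun a => X j a + eps * U0 i j a) = dot u (X j) + eps * dot u (U0 i j).
    rewrite /dot mulr_sumr -big_split; apply: eq_bigr => a _; rewrite /=; ring.
  rewrite !Ydot /delta !dotBr !dotBl !(dotC (X j)) (dotC (U0 i j) (U1 i j)).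
  by rewrite oU // oU1 // eqxx; field.
Qed.
End TensorCalculus.
Arguments grad {R k n} A U i j a.
Arguments delta {R k n} U1 U0 i j a.

(** * One iteration of the algorithm *)

Section Step.
Variables (R : realType) (k : nat) (n : 'I_k -> nat) (A : @tensor R k n).
Variables (s : nat) (eps kappa : R).
Hypotheses (eps_gt0 : 0 < eps) (kappa_gt0 : 0 < kappa) (s_gt0 : (0 < s)%N).
Implicit Types (U : @iterate R k n).

Lemma block_update_weaken t c c' U1 U0 i : c' <= c ->
  block_update A s t eps c U1 U0 i -> block_update A s t eps c' U1 U0 i.
Proof.
move=> cc [hS gain]; split=> //; apply: le_trans gain; rewrite ler_wpM2r //.
by apply: sumr_ge0 => j _; exact: dot_ge0.
Qed.

(** The auxiliary iterate of a step is tied to the next iterate only in the blocks below [s]; this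
    transfers the polar updates from the former to the latter. *)
Lemma eq_block_update t c U1 V U0 (i : 'I_k) :
  (forall (l : 'I_k) j, (l <= i)%N -> (j < t)%N -> U1 l j = V l j) ->
  block_update A s t eps c U1 U0 i -> block_update A s t eps c V U0 i.
Proof.
move=> UV.
have mixE m (j : nat) : (m <= i.+1)%N -> (j < t)%N ->
    colsof n (mixn m U1 U0) j = colsof n (mixn m V U0) j.
  move=> mi jt; apply: functional_extensionality_dep => l; rewrite /colsof /mixn.
  by case: ifP => // lm; rewrite UV // -ltnS (leq_trans lm).
have gE j : (j < t)%N -> grad A (mixn i U1 U0) i j = grad A (mixn i V U0) i j.
  by move=> jt; rewrite /grad /lam mixE // leqnSn.
have dE j : (j < t)%N -> delta U1 U0 i j = delta V U0 i j by move=> jt; rewrite /delta UV.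
have fE m : (m <= i.+1)%N -> fobj n A t (mixn m U1 U0) = fobj n A t (mixn m V U0).
  by move=> mi; apply: eq_bigr => j _; rewrite /lam mixE.
move=> [[S [symS diagS hS]] gain]; split.
  exists S; split=> // j x jt; rewrite -gE // -dE //; apply: le_trans (hS j x jt).
  by under eq_bigr => a _ do rewrite -UV //.
rewrite -!fE // ?leqnSn //; apply: le_trans gain.
by under eq_bigr => j _ do rewrite -dE //.
Qed.

Definition als_column U1 U0 (i : 'I_k) j :=
  U1 i j = fun a => Num.sg (lam n A (mixn i U1 U0) j) /
    vnorm (tau_i n A i (colsof n (mixn i U1 U0) j)) * tau_i n A i (colsof n (mixn i U1 U0) j) a.

Lemma als_column_update U1 U0 i j : als_column U1 U0 i j ->
  dot (U0 i j) (U0 i j) = 1 -> kappa <= `|lam n A (mixn i U1 U0) j| ->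
  let w := tau_i n A i (colsof n (mixn i U1 U0) j) in
  [/\ dot (U1 i j) (U1 i j) = 1,
      `|lam n A (mixn i U1 U0) j| <= `|lam n A (mixn i.+1 U1 U0) j|,
      kappa ^+ 2 * dot (delta U1 U0 i j) (delta U1 U0 i j) <=
        lam n A (mixn i.+1 U1 U0) j ^+ 2 - lam n A (mixn i U1 U0) j ^+ 2 &
      exists p, forall a, grad A (mixn i U1 U0) i j a = U1 i j a * p].
Proof.
move=> uE u1 kl w; have lE := lam_mix_old A U1 U0 i j.
have := als_update (w := w) kappa_gt0 u1; rewrite -lE => /(_ kl) /=.
rewrite -uE -lam_mix_new => -[h1 h2 h3 h4].
by rewrite /delta /grad -/w uE; split=> //; rewrite -uE.
Qed.

Lemma als_block_update t U1 U0 (i : 'I_k) : (s <= i)%N -> unitcols t (U0 i) ->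
  (forall j, (j < t)%N -> kappa <= `|lam n A (mixn i U1 U0) j|) ->
  (forall j, (j < t)%N -> als_column U1 U0 i j) ->
  block_update A s t eps (kappa ^+ 2) U1 U0 i.
Proof.
move=> si uU0 kl hU; split; last first.
  rewrite /fobj -sumrB mulr_sumr; apply: ler_sum => j _.
  by have [] := als_column_update (hU j (ltn_ord j)) (uU0 j (ltn_ord j)) (kl j (ltn_ord j)).
exists (fun a j => (a == j)%:R * dot (U1 i j) (grad A (mixn i U1 U0) i j)); split.
- by move=> a j _ _; rewrite eq_sym; case: eqP => [->|] //; rewrite !mul0r.
- by move=> a j _ _ _ /negbTE ->; rewrite mul0r.
move=> j x jt; have [u1 _ _ [p hp]] := als_column_update (hU j jt) (uU0 j jt) (kl j jt).
rewrite (bigD1 (Ordinal jt)) //= eqxx mul1r big1 => [|a aj].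
  have -> : dot (U1 i j) (grad A (mixn i U1 U0) i j) = p.
    rewrite -[RHS]mul1r -u1 /dot mulr_suml; apply: eq_bigr => a _.
    by rewrite hp mulrA.
  by rewrite addr0 hp subrr normr0 mulr_ge0 // ltW.
by rewrite (_ : (a == j :> nat) = false) ?mul0r ?mulr0 //; apply: negbTE.
Qed.

Lemma iapd_step_spec (st st' : @state R k n) : iapd_step n A s eps kappa st st' ->
  feasible n s st.1 st.2 ->
  [/\ (st'.1 <= st.1)%N, feasible n s st'.1 st'.2 &
      st'.1 = st.1 -> forall i, block_update A s st.1 eps (Num.min eps (kappa ^+ 2)) st'.2 st.2 i].
Proof.
case: st st' => t U0 [t' V] [/= U1 [hpol [ht' hV]]] feas.
move: ht' hV; set keep := [seq j <- _ | _] => -> hV.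
(* The diagonal entry tested by the truncation is the value of [lam] after the first [s] blocks. *)
have memk j : j \in keep -> (j < t)%N /\ forall i : 'I_k, i.+1 = s ->
    kappa <= `|lam n A (mixn s U1 U0) j|.
  rewrite mem_filter mem_iota add0n => /and3P[/forallP h _ ->]; split=> // i iS.
  by have := h i; rewrite iS eqxx /=; rewrite -iS lam_mix_new.
have uk : uniq keep by rewrite filter_uniq // iota_uniq.
pose K0 := fun (l : 'I_k) j => U0 l (nth 0%N keep j).
have oU1 (i : 'I_k) : (i < s)%N -> orthonormal t (U1 i).
  move=> i_s; have [Q0 [oQ _] [[_ UQ]|[_ [oU _]]]] := hpol i i_s => //.
  by move=> a j at_ jt; rewrite !UQ //; exact: oQ.
have ltk j : (j < size keep)%N -> (nth 0%N keep j < t)%N.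
  by move=> js; have [] := memk _ (mem_nth 0%N js).
have VE (i : 'I_k) j : (j < size keep)%N -> (i < s)%N -> V i j = U1 i (nth 0%N keep j).
  by move=> js; exact: (hV i j js).1.
have Vals (i : 'I_k) j : (j < size keep)%N -> (s <= i)%N -> als_column V K0 i j.
  by move=> js; exact: (hV i j js).2.
have K0unit (i : 'I_k) j : (j < size keep)%N -> (s <= i)%N -> dot (K0 i j) (K0 i j) = 1.
  by move=> js si; apply: (feas i).2 => //; exact: ltk.
(* An alternating update never decreases [|lam|], so the bound secured by the truncation persists
   through the remaining blocks: no normalization divides by zero and each gains at rate
   [kappa ^+ 2]. *)
have lower m j : (j < size keep)%N -> (s <= m)%N -> (m <= k)%N -> kappa <= `|lam n A (mixn m V K0) j|.
  move=> js; elim: m => [|m IH] sm mk; first by move: sm; rewrite leqNgt s_gt0.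
  move: sm; rewrite leq_eqVlt => /predU1P[sE|sm].
    have [_ /(_ (Ordinal mk))] := memk _ (mem_nth 0%N js); rewrite -sE => /(_ erefl).
    congr (_ <= `|_|); apply: eq_tau => l; rewrite /colsof /mixn.
    by case: ifP => // ls; rewrite VE.
  have [_ h _ _] := als_column_update (Vals (Ordinal mk) j js sm) (K0unit (Ordinal mk) j js sm) (IH sm (ltnW mk)).
  exact: le_trans (IH sm (ltnW mk)) h.
have feasV : feasible n s (size keep) V.
  move=> l; split=> [ls a j ak jk|sl j jk].
    by rewrite !VE // oU1 ?ltk // nth_uniq.
  by have [] := als_column_update (Vals l j jk sl) (K0unit l j jk sl) (lower l j jk sl (ltnW (ltn_ord l))).
have le_t : (size keep <= t)%N by rewrite -[leqRHS](size_iota 0) size_filter count_size.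
split=> // szt i.
have keepE : keep = iota 0 t.
  by apply/all_filterP; rewrite all_count size_iota -size_filter szt.
have nthk j : (j < t)%N -> nth 0%N keep j = j by move=> jt; rewrite keepE nth_iota.
have K0E (l : 'I_k) j : (j < t)%N -> K0 l j = U0 l j by move=> jt; rewrite /K0 nthk.
rewrite szt in VE Vals lower K0unit.
have mixE m (j : nat) : (j < t)%N -> colsof n (mixn m V K0) j = colsof n (mixn m V U0) j.
  move=> jt; apply: functional_extensionality_dep => l.
  by rewrite /colsof /mixn K0E.
have [i_s|si] := ltnP i s; last first.
  apply: (@block_update_weaken _ (kappa ^+ 2)); first by rewrite ge_min lexx orbT.
  apply: als_block_update => //.
  - exact: (feas i).2.
  - move=> j jt; have := lower i j jt si (ltnW (ltn_ord i)).
    by rewrite /lam mixE.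
  - by move=> j jt; have := Vals i j jt si; rewrite /als_column /lam mixE.
apply: (@block_update_weaken _ eps); first by rewrite ge_min lexx.
 apply: (@eq_block_update _ _ U1).
  by move=> l j li jt; rewrite VE ?nthk // (leq_ltn_trans li).
have [Q0 pol cases] := hpol i i_s.
apply: (polar_block_update (Q0 := Q0)) => //; first exact: (feas i).1.
by case: cases => [|[_]]; [left|right].
Qed.
End Step.

(** * The objective in coordinates *)

Section UniformBounds.
Variable R : realType.

Lemma norm_sum_le (J : finType) (F : J -> R) (c : R) :
  (forall j, `|F j| <= c) -> `|\sum_j F j| <= #|J|%:R * c.
Proof.
move=> h; apply: (le_trans (ler_norm_sum _ _ _)).
by apply: (le_trans (ler_sum _ (fun j _ => h j))); rewrite sumr_const mulr_natl.
Qed.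

(** The common constant is 1 plus the sum of the individual ones; the 1 keeps it positive when [J]
    is empty. *)
Lemma finite_uniform (J : finType) (Q : J -> R -> Prop) :
  (forall j c c', c <= c' -> Q j c -> Q j c') -> (forall j, exists2 c, 0 < c & Q j c) ->
  exists2 c, 0 < c & forall j, Q j c.
Proof.
move=> mono h; have {}h j : exists c, 0 < c /\ Q j c by have [c] := h j; exists c.
have [f hf] := choice h; have f0 j : 0 <= f j by rewrite ltW // (hf j).1.
exists (1 + \sum_j f j) => [|j]; first by rewrite ltr_wpDr ?sumr_ge0.
apply: mono (hf j).2; rewrite (bigD1 j) //=.
have : 0 <= \sum_(i | i != j) f i by exact: sumr_ge0.
by lra.
Qed.
End UniformBounds.

Section Coordinates.
Variables (R : realType) (k : nat) (n : 'I_k -> nat) (A : @tensor R k n) (s t : nat).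

Definition entry : finType := {l : 'I_k & ('I_t * 'I_(n l))%type}.
Definition mkentry (l : 'I_k) (j : 'I_t) (a : 'I_(n l)) : entry :=
  Tagged (fun l => ('I_t * 'I_(n l))%type) (j, a).
Local Notation N := #|entry|.

Definition encode (U : @iterate R k n) : 'rV[R]_N :=
  \row_(m < N) let e : entry := enum_val m in
    U (tag e) (nat_of_ord (tagged e).1) (tagged e).2.
(** Columns from [t] on are filled with 0, so [encode] undoes [decode] exactly, while the other
    composite is the identity only on columns below [t]. *)
Definition decode (v : 'rV[R]_N) : @iterate R k n := fun l j a =>
  if (insub j : option 'I_t) is Some j' then v 0 (enum_rank (mkentry j' a)) else 0.

Arguments decode : clear implicits.

Lemma encodeE U l (j : 'I_t) a : encode U 0 (enum_rank (mkentry j a)) = U l j a.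
Proof. by rewrite mxE enum_rankK. Qed.

Lemma decodeE v (l : 'I_k) (j : 'I_t) a : decode v l j a = v 0 (enum_rank (mkentry j a)).
Proof. by rewrite /decode valK. Qed.

Lemma encodeK U l j : (j < t)%N -> decode (encode U) l j = U l j.
Proof. by move=> jt; apply/funext => a; rewrite (decodeE _ (Ordinal jt)) encodeE. Qed.

Lemma entry_ind (Q : 'I_N -> Prop) :
  (forall l (j : 'I_t) (a : 'I_(n l)), Q (enum_rank (mkentry j a))) -> forall m, Q m.
Proof. by move=> h m; rewrite -(enum_valK m); case: (enum_val m) => l [j a]; exact: h. Qed.

Lemma sum_entry (F : 'I_N -> R) :
  \sum_m F m = \sum_l \sum_(j < t) \sum_(a < n l) F (enum_rank (mkentry j a)).
Proof.
rewrite (reindex (@enum_rank entry)); last exact/onW_bij/enum_rank_bij.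
rewrite (eq_bigr (fun l => \sum_(p : 'I_t * 'I_(n l)) F (enum_rank (mkentry p.1 p.2)))); last first.
  by move=> l _; rewrite pair_bigA.
by rewrite sig_big_dep /=; apply: eq_bigr => -[l [j a]].
Qed.

Definition bounded_by_1 (U : @iterate R k n) := forall l j a, (j < t)%N -> `|U l j a| <= 1.
Definition idist (U V : @iterate R k n) := dist1 (encode U) (encode V).

Lemma encode_cube U : bounded_by_1 U -> in_cube 1 (encode U).
Proof. by move=> hU; elim/entry_ind => l j a; rewrite encodeE hU. Qed.

Lemma delta_le_idist U V l j a : (j < t)%N -> `|delta U V l j a| <= idist U V.
Proof.
move=> jt; have := coord_le_dist1 (encode U) (encode V) (enum_rank (mkentry (Ordinal jt) a)).
by rewrite !encodeE.
Qed.

Lemma idist_mix_le m U1 U0 : idist (mixn m U1 U0) U0 <= idist U1 U0.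
Proof.
rewrite /idist /dist1 !sum_entry; do 3!(apply: ler_sum => ? _); rewrite !encodeE /mixn.
by case: ifP => // _; rewrite subrr normr0.
Qed.

Lemma idist_mix_new_le m U1 U0 : idist (mixn m U1 U0) U1 <= idist U1 U0.
Proof.
rewrite /idist /dist1 !sum_entry; do 3!(apply: ler_sum => ? _); rewrite !encodeE /mixn.
by case: ifP => // _; rewrite ?subrr ?normr0 // distrC.
Qed.

Lemma bounded_mix m U1 U0 : bounded_by_1 U1 -> bounded_by_1 U0 -> bounded_by_1 (mixn m U1 U0).
Proof. by move=> h1 h0 l j a jt; rewrite /mixn; case: ifP => _; [exact: h1|exact: h0]. Qed.

Lemma feasible_bounded U : feasible n s t U -> bounded_by_1 U.
Proof.
move=> feas l j a jt; have u1 : dot (U l j) (U l j) = 1.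
  have [ls|sl] := ltnP l s; last exact: (feas l).2.
  by rewrite ((feas l).1 ls) // eqxx.
rewrite -(@ler_pXn2r _ 2) ?nnegrE // expr1n real_normK ?num_real // -u1 /dot (bigD1 a) //= expr2.
by rewrite lerDl sumr_ge0 // => b _; rewrite -expr2 sqr_ge0.
Qed.

Lemma polyf_decode l j a : polyf (fun v => decode v l j a).
Proof.
rewrite /decode; case: insubP => [j' _ _|_]; [exact: polyf_var|exact: polyf_cst].
Qed.

Lemma polyf_dot m (f g : 'rV[R]_N -> 'I_m -> R) :
  (forall x, polyf (f^~ x)) -> (forall x, polyf (g^~ x)) -> polyf (fun v => dot (f v) (g v)).
Proof. by move=> hf hg; apply: polyf_sum => x _; apply: polyfM. Qed.

Lemma polyf_tau_i l j a : polyf (fun v => tau_i n A l (colsof n (decode v) j) a).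
Proof.
apply: polyf_sum => idx _; apply: polyfM (polyf_cst _) _.
by apply: polyf_prod => i _; exact: polyf_decode.
Qed.

Lemma polyf_lam j : polyf (fun v => lam n A (decode v) j).
Proof.
apply: polyf_sum => idx _; apply: polyfM (polyf_cst _) _.
by apply: polyf_prod => i _; exact: polyf_decode.
Qed.

Lemma polyf_grad l j a : polyf (fun v => grad A (decode v) l j a).
Proof. by rewrite /grad; apply: polyfM; [exact: polyf_tau_i|exact: polyf_lam]. Qed.

(* The Lagrange multiplier: the symmetric part of U^T X for an orthonormal block, the diagonal of
   U^T X for a block of unit columns, where X is the gradient block. *)
Definition multiplier (U : @iterate R k n) (l : 'I_k) (a j : nat) : R :=
  if (l < s)%N then (dot (U l a) (grad A U l j) + dot (U l j) (grad A U l a)) / 2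
  else (a == j)%:R * dot (U l j) (grad A U l j).

Definition residual (U : @iterate R k n) (l : 'I_k) (j : nat) (x : 'I_(n l)) : R :=
  grad A U l j x - \sum_(a < t) U l a x * multiplier U l a j.
Arguments residual : clear implicits.

Lemma multiplier_sym U l a j : multiplier U l a j = multiplier U l j a.
Proof.
rewrite /multiplier; case: ifP => _; first by rewrite addrC.
by case: (eqVneq a j) => [->|] //; rewrite !mul0r.
Qed.

Lemma polyf_multiplier l a j : polyf (fun v => multiplier (decode v) l a j).
Proof.
rewrite /multiplier; case: (l < s)%N.
  apply: polyfM; last exact: polyf_cst.
  apply: polyfD; apply: polyf_dot => x;
  [exact: polyf_decode|exact: polyf_grad|exact: polyf_decode|exact: polyf_grad].
apply: polyfM (polyf_cst _) _; apply: polyf_dot => x; [exact: polyf_decode|exact: polyf_grad].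
Qed.

Lemma polyf_residual l j x : polyf (fun v => residual (decode v) l j x).
Proof.
rewrite /residual; apply: polyfB; first exact: polyf_grad.
by apply: polyf_sum => a _; apply: polyfM; [exact: polyf_decode|exact: polyf_multiplier].
Qed.

Definition objective v := fobj n A t (decode v).
(* The factor 2 makes the gap dominate the slope of the objective with constant 1. *)
Definition stationarity_gap v :=
  \sum_(l < k) \sum_(j < t) \sum_(x < n l) (2 * residual (decode v) l j x) ^+ 2.
(** A sum of squares merges all constraints into the single polynomial equation [H = 0] of the
    desingularization. *)
Definition constraint_gap (v : 'rV[R]_N) :=
  \sum_(l < k) \sum_(a < t) \sum_(j < t) ((l < s)%N || (a == j))%:R *
    (dot (decode v l a) (decode v l j) - (a == j)%:R) ^+ 2.

Lemma polyf_objective : polyf objective.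
Proof. by apply: polyf_sum => j _; apply: polyfM; exact: polyf_lam. Qed.

Lemma polyf_stationarity_gap : polyf stationarity_gap.
Proof.
apply: polyf_sum => l _; apply: polyf_sum => j _; apply: polyf_sum => x _.
by apply: polyfM; (apply: polyfM; first exact: polyf_cst); exact: polyf_residual.
Qed.

Lemma polyf_constraint_gap : polyf constraint_gap.
Proof.
apply: polyf_sum => l _; apply: polyf_sum => a _; apply: polyf_sum => j _.
apply: polyfM (polyf_cst _) _.
by apply: polyfM; (apply: polyfB; last exact: polyf_cst); apply: polyf_dot => x; exact: polyf_decode.
Qed.

Lemma stationarity_gap_ge0 v : 0 <= stationarity_gap v.
Proof. by do 3!(apply: sumr_ge0 => ? _); exact: sqr_ge0. Qed.

Lemma residual_le_gap v l (j : 'I_t) x :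
  `|2 * residual (decode v) l j x| <= Num.sqrt (stationarity_gap v).
Proof.
rewrite -sqrtr_sqr ler_wsqrtr // /stationarity_gap (bigD1 l) //= (bigD1 j) //= (bigD1 x) //=.
rewrite -!addrA lerDl !addr_ge0 //; do ?[apply: sumr_ge0 => ? _]; exact: sqr_ge0.
Qed.

Lemma constraint_gapP v : constraint_gap v = 0 <-> feasible n s t (decode v).
Proof.
have pos (l : 'I_k) (a j : 'I_t) : 0 <= ((l < s)%N || (a == j))%:R *
    (dot (decode v l a) (decode v l j) - (a == j)%:R) ^+ 2.
  by rewrite mulr_ge0 ?sqr_ge0.
split=> [h l|feas].
  have key (a j : 'I_t) : ((l < s)%N || (a == j)) -> dot (decode v l a) (decode v l j) = (a == j)%:R.
    move=> c; move/eqP: h; rewrite psumr_eq0; last by move=> *; do 2!(apply: sumr_ge0 => ? _).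
    move=> /allP/(_ l (mem_index_enum _))/=; rewrite psumr_eq0; last by move=> *; apply: sumr_ge0.
    move=> /allP/(_ a (mem_index_enum _))/=; rewrite psumr_eq0 //.
    move=> /allP/(_ j (mem_index_enum _))/=; rewrite c mul1r sqrf_eq0 subr_eq0.
    by move=> /eqP.
  split=> [ls a j at_ jt|_ j jt]; first by apply: (key (Ordinal at_) (Ordinal jt)); rewrite ls.
  by have := key (Ordinal jt) (Ordinal jt); rewrite !eqxx orbT => ->.
rewrite /constraint_gap big1 // => l _; rewrite big1 // => a _; rewrite big1 // => j _.
have [ls|sl] /= := ltnP l s.
  by rewrite ((feas l).1 ls) // subrr expr0n mulr0.
by case: eqP => [->|_]; rewrite ?mul0r // ((feas l).2 sl) // subrr expr0n mulr0.
Qed.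
End Coordinates.
Arguments residual {R k n} A s t U l j x.
Arguments encode {R k n} t U.
Arguments decode {R k n t} v l j a.
Arguments idist {R k n} t U V.
Arguments bounded_by_1 {R k n} t U.
Arguments multiplier {R k n} A s U l a j.
Arguments objective {R k n} A t v.
Arguments stationarity_gap {R k n} A s t v.
Arguments constraint_gap {R k n} s t v.
Arguments polyf_tau_i {R k n} A t l j a.
Arguments polyf_grad {R k n} A t l j a.
Arguments polyf_multiplier {R k n} A s t l a j.

(** * Slope, ascent and error estimates for a sweep *)

Section Convergence.
Variables (R : realType) (k : nat) (n : 'I_k -> nat) (A : @tensor R k n) (s t : nat).
Local Notation bnd := (bounded_by_1 t).
Local Notation dist := (idist t).
Local Notation N := #|entry n t|.
Implicit Types (U V Y : @iterate R k n).

Lemma decodeK (v : 'rV[R]_N) : encode t (decode v) = v.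
Proof. by apply/rowP; elim/entry_ind => l j a; rewrite encodeE decodeE. Qed.

Lemma colsof_encodeK U j : (j < t)%N -> colsof n (decode (encode t U)) j = colsof n U j.
Proof. by move=> jt; apply: functional_extensionality_dep => l; exact: encodeK. Qed.

Lemma grad_encodeK U l j : (j < t)%N -> grad A (decode (encode t U)) l j = grad A U l j.
Proof. by move=> jt; apply/funext => x; rewrite /grad /lam colsof_encodeK. Qed.

Lemma multiplier_encodeK U l a j : (a < t)%N -> (j < t)%N ->
  multiplier A s (decode (encode t U)) l a j = multiplier A s U l a j.
Proof. by move=> at_ jt; rewrite /multiplier !encodeK // !grad_encodeK. Qed.

Lemma idist_ge0 U V : 0 <= dist U V.
Proof. exact: dist1_ge0. Qed.

Lemma grad_lipschitz : exists2 C, 0 < C & forall U V, bnd U -> bnd V ->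
  forall l j x, (j < t)%N -> `|grad A U l j x - grad A V l j x| <= C * dist U V.
Proof.
have [e c c' cc h U V bU bV|e|C C0 hC] := @finite_uniform R (entry n t) (fun e c => forall U V, bnd U -> bnd V ->
    `|grad A U (tag e) (nat_of_ord (tagged e).1) (tagged e).2 -
      grad A V (tag e) (nat_of_ord (tagged e).1) (tagged e).2| <= c * dist U V).
- by apply: (le_trans (h U V bU bV)); rewrite ler_wpM2r // idist_ge0.
- have [C C0 hC] := polyf_lipschitz 1 (polyf_grad A t (tag e) (nat_of_ord (tagged e).1) (tagged e).2).
  exists C => // U V bU bV; have := hC _ _ (encode_cube bU) (encode_cube bV).
  by rewrite !grad_encodeK.
- by exists C => // U V bU bV l j x jt; exact: (hC (mkentry (Ordinal jt) x) U V bU bV).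
Qed.

Lemma tau_i_bounded : exists2 C, 0 < C & forall U, bnd U ->
  forall l j x, (j < t)%N -> `|tau_i n A l (colsof n U j) x| <= C.
Proof.
have [e c c' cc h U bU|e|C C0 hC] := @finite_uniform R (entry n t) (fun e c => forall U, bnd U ->
    `|tau_i n A (tag e) (colsof n U (nat_of_ord (tagged e).1)) (tagged e).2| <= c).
- exact: le_trans (h U bU) cc.
- have [C C0 hC] := polyf_bounded 1 (polyf_tau_i A t (tag e) (nat_of_ord (tagged e).1) (tagged e).2).
  by exists C => // U bU; have := hC _ (encode_cube bU); rewrite colsof_encodeK.
- by exists C => // U bU l j x jt; exact: (hC (mkentry (Ordinal jt) x) U bU).
Qed.

Lemma multiplier_bounded : exists2 C, 0 < C & forall U, bnd U ->
  forall l a j, (a < t)%N -> (j < t)%N -> `|multiplier A s U l a j| <= C.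
Proof.
have [e c c' cc h U bU|[l [a j]]|C C0 hC] := @finite_uniform R ('I_k * ('I_t * 'I_t))%type
  (fun e c => forall U, bnd U -> `|multiplier A s U e.1 e.2.1 e.2.2| <= c).
- exact: le_trans (h U bU) cc.
- have [C C0 hC] := polyf_bounded 1 (polyf_multiplier A s t l a j).
  by exists C => // U bU; have := hC _ (encode_cube bU); rewrite multiplier_encodeK.
- by exists C => // U bU l a j at_ jt; exact: (hC (l, (Ordinal at_, Ordinal jt)) U bU).
Qed.

Lemma dot_bound m (f g : 'I_m -> R) a b :
  (forall x, `|f x| <= a) -> (forall x, `|g x| <= b) -> `|dot f g| <= m%:R * (a * b).
Proof.
move=> hf hg; have := @norm_sum_le R 'I_m (fun x => f x * g x) (a * b).
by rewrite card_ord; apply => x; rewrite normrM ler_pM.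
Qed.

Lemma sum_bound m (F : nat -> R) c :
  (forall j, (j < m)%N -> `|F j| <= c) -> `|\sum_(j < m) F j| <= m%:R * c.
Proof. by move=> h; have := @norm_sum_le R 'I_m F c; rewrite card_ord; apply => j; exact: h. Qed.

(** Write the gradient at [U] as the residual plus [U] times the multiplier: since both points are
    feasible, [block_identity] makes the multiplier part of second order. *)
Lemma block_slope (i : 'I_k) : exists2 c, 0 < c & forall U Y, feasible n s t U -> feasible n s t Y ->
  `|fobj n A t (mixn i.+1 Y U) - fobj n A t (mixn i Y U) -
    \sum_(j < t) \sum_(x < n i) 2 * residual A s t U i j x * delta Y U i j x| <= c * dist Y U ^+ 2.
Proof.
have [Cg Cg0 hCg] := grad_lipschitz; have [Bt Bt0 hBt] := tau_i_bounded.
have [Bp Bp0 hBp] := multiplier_bounded.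
(* One summand each for the change of gradient between [U] and the mixed iterate, the multiplier
   term and the exact quadratic term; the 1 ensures positivity. *)
exists (2 * (t%:R * ((n i)%:R * Cg)) + t%:R * (t%:R * (Bp * (n i)%:R)) + t%:R * ((n i)%:R * Bt) ^+ 2 + 1).
  by rewrite ltr_wpDl // !addr_ge0 ?mulr_ge0 ?sqr_ge0 ?(ltW Cg0) ?(ltW Bp0) ?(ltW Bt0).
move=> U Y fU fY; have bU := feasible_bounded fU; have bY := feasible_bounded fY.
have bM := bounded_mix i bY bU.
set D := dist Y U; have D0 : 0 <= D by exact: idist_ge0.
rewrite fobj_block_gain; set M := mixn i Y U in bM *; set d := delta Y U i.
have hd j x : (j < t)%N -> `|d j x| <= D by exact: delta_le_idist.
pose e j x := grad A M i j x - grad A U i j x.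
have he j x : (j < t)%N -> `|e j x| <= Cg * D.
  move=> jt; apply: (le_trans (hCg _ _ bM bU i j x jt)).
  by rewrite ler_pM2l //; exact: idist_mix_le.
have id : \sum_(j < t) dot (fun x => \sum_(a < t) U i a x * multiplier A s U i a j) (d j) =
    - (\sum_(a < t) \sum_(j < t) multiplier A s U i a j * dot (d a) (d j)) / 2.
  apply: (@block_identity R (n i) t (multiplier A s U i) (U i) (Y i)) => a j at_ jt.
    exact: multiplier_sym.
  have [is_|si] := ltnP i s.
    by rewrite ((fU i).1 is_) // ((fY i).1 is_) // subrr mulr0.
  rewrite /multiplier ltnNge si /=; case: (eqVneq a j) => [->|_]; last by rewrite !mul0r.
  by rewrite ((fU i).2 si) // ((fY i).2 si) // subrr mulr0.
have -> : 2 * \sum_(j < t) dot (grad A M i j) (d j) +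
    \sum_(j < t) dot (tau_i n A i (colsof n M j)) (d j) ^+ 2 -
    \sum_(j < t) \sum_(x < n i) 2 * residual A s t U i j x * d j x =
    2 * \sum_(j < t) dot (e j) (d j) +
    - (\sum_(a < t) \sum_(j < t) multiplier A s U i a j * dot (d a) (d j)) +
    \sum_(j < t) dot (tau_i n A i (colsof n M j)) (d j) ^+ 2.
  have -> : \sum_(j < t) \sum_(x < n i) 2 * residual A s t U i j x * d j x =
      2 * \sum_(j < t) dot (grad A M i j) (d j) - 2 * \sum_(j < t) dot (e j) (d j) -
      2 * \sum_(j < t) dot (fun x => \sum_(a < t) U i a x * multiplier A s U i a j) (d j).
    rewrite -!mulrBr -!sumrB mulr_sumr; apply: eq_bigr => j _.
    rewrite /dot -!sumrB mulr_sumr; apply: eq_bigr => x _.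
    by rewrite /residual /e; ring.
  by rewrite id; lra.
have h1 : `|\sum_(j < t) dot (e j) (d j)| <= t%:R * ((n i)%:R * (Cg * D * D)).
  by apply: (@sum_bound t (fun j => dot (e j) (d j))) => j jt; apply: dot_bound => x; [exact: he|exact: hd].
have h2 : `|\sum_(a < t) \sum_(j < t) multiplier A s U i a j * dot (d a) (d j)| <=
    t%:R * (t%:R * (Bp * ((n i)%:R * (D * D)))).
  apply: (@sum_bound t (fun a => \sum_(j < t) multiplier A s U i a j * dot (d a) (d j))) => a at_.
  apply: (@sum_bound t (fun j => multiplier A s U i a j * dot (d a) (d j))) => j jt.
  by rewrite normrM ler_pM ?hBp //; apply: dot_bound => x; exact: hd.
have h3 : `|\sum_(j < t) dot (tau_i n A i (colsof n M j)) (d j) ^+ 2| <= t%:R * ((n i)%:R * (Bt * D)) ^+ 2.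
  apply: (@sum_bound t (fun j => dot (tau_i n A i (colsof n M j)) (d j) ^+ 2)) => j jt.
  rewrite normrX ler_pXn2r ?nnegrE ?mulr_ge0 ?(ltW Bt0) //.
  by apply: dot_bound => x; [exact: hBt|exact: hd].
apply: (le_trans (ler_normD _ _)); apply: (le_trans (lerD (ler_normD _ _) h3)).
rewrite normrN normrM ger0_norm //.
have D2 := sqr_ge0 D.
move: h1 h2; set X1 := `|_|; set X2 := `|_| => h1 h2.
lra.
Qed.

(** Blocks are exchanged one at a time, yet every residual is taken at [U], so the linear terms
    assemble into the gap at [v]. Each residual entry is at most the root of the gap, which matches
    the l1 distance. *)
Lemma objective_slope : exists2 C, 0 < C & forall v w,
  constraint_gap s t v = 0 -> constraint_gap s t w = 0 ->
  `|objective A t v - objective A t w| <=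
     (Num.sqrt (stationarity_gap A s t v) + C * dist1 v w) * dist1 v w.
Proof.
have [i c c' cc h U Y fU fY|i|c c0 hc] := @finite_uniform R 'I_k (fun i c => forall U Y,
   feasible n s t U -> feasible n s t Y ->
   `|fobj n A t (mixn i.+1 Y U) - fobj n A t (mixn i Y U) -
    \sum_(j < t) \sum_(x < n i) 2 * residual A s t U i j x * delta Y U i j x| <= c * dist Y U ^+ 2).
- by apply: (le_trans (h U Y fU fY)); rewrite ler_wpM2r ?sqr_ge0.
- exact: block_slope.
exists (k%:R * c + 1) => [|v w /constraint_gapP fU /constraint_gapP fY].
  by rewrite ltr_wpDl // mulr_ge0 // ltW.
set U := decode v in fU *; set Y := decode w in fY *.
have DE : dist Y U = dist1 v w by rewrite /idist !decodeK dist1C.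
rewrite -DE; set D := dist Y U; have D0 : 0 <= D by exact: idist_ge0.
rewrite distrC /objective -/U -/Y fobj_telescope.
have -> : \sum_(i < k) (fobj n A t (mixn i.+1 Y U) - fobj n A t (mixn i Y U)) =
  \sum_(i < k) (fobj n A t (mixn i.+1 Y U) - fobj n A t (mixn i Y U) -
    \sum_(j < t) \sum_(x < n i) 2 * residual A s t U i j x * delta Y U i j x) +
  \sum_(i < k) \sum_(j < t) \sum_(x < n i) 2 * residual A s t U i j x * delta Y U i j x.
  by rewrite -big_split; apply: eq_bigr => i _; rewrite /= subrK.
apply: (le_trans (ler_normD _ _)).
have h1 : `|\sum_(i < k) (fobj n A t (mixn i.+1 Y U) - fobj n A t (mixn i Y U) -
    \sum_(j < t) \sum_(x < n i) 2 * residual A s t U i j x * delta Y U i j x)| <= k%:R * (c * D ^+ 2).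
  by have := @norm_sum_le R 'I_k; rewrite card_ord; apply => i; exact: hc.
have h2 : `|\sum_(i < k) \sum_(j < t) \sum_(x < n i) 2 * residual A s t U i j x * delta Y U i j x| <=
    Num.sqrt (stationarity_gap A s t v) * D.
  apply: (le_trans (ler_norm_sum _ _ _)); rewrite /D /idist /dist1 sum_entry mulr_sumr.
  apply: ler_sum => i _; apply: (le_trans (ler_norm_sum _ _ _)); rewrite mulr_sumr.
  apply: ler_sum => j _; apply: (le_trans (ler_norm_sum _ _ _)); rewrite mulr_sumr.
  apply: ler_sum => x _; rewrite normrM !encodeE ler_wpM2r //.
  exact: residual_le_gap.
have := sqr_ge0 D; rewrite mulrDl mulrDl mul1r; move: h1 h2; rewrite expr2; lra.
Qed.

Variables (eps c : R).
Hypotheses (eps_gt0 : 0 < eps) (c_gt0 : 0 < c).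

(** The update comes with its own multiplier [S], at a mixed iterate. With [E = grad - U1 S] at
    [U1], the multiplier in [residual] differs from [S] by the symmetrized (or diagonal) part [PE]
    of [U1^T E]. The residual is thus [E - U1 PE], and [E] is of the order of the displacement. *)
Lemma block_residual (i : 'I_k) : exists2 b, 0 < b & forall U1 U0,
  feasible n s t U1 -> feasible n s t U0 -> block_update A s t eps c U1 U0 i ->
  forall j x, (j < t)%N -> `|2 * residual A s t U1 i j x| <= b * dist U1 U0.
Proof.
have [Cg Cg0 hCg] := grad_lipschitz.
have ce0 : 0 < Cg + eps by exact: addr_gt0.
exists (2 * ((Cg + eps) + t%:R * ((n i)%:R * (Cg + eps)))).
  by rewrite mulr_gt0 // ltr_wpDr // !mulr_ge0 // ltW.
move=> U1 U0 f1 f0 [[S [symS diagS hS]] _].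
have b1 := feasible_bounded f1; have b0 := feasible_bounded f0.
have bM := bounded_mix i b1 b0.
set D := dist U1 U0; have D0 : 0 <= D by exact: idist_ge0.
pose E j x := grad A U1 i j x - \sum_(a < t) U1 i a x * S a j.
have hE j x : (j < t)%N -> `|E j x| <= (Cg + eps) * D.
  move=> jt; have -> : E j x = (grad A U1 i j x - grad A (mixn i U1 U0) i j x) +
     (grad A (mixn i U1 U0) i j x - \sum_(a < t) U1 i a x * S a j) by rewrite /E; ring.
  apply: (le_trans (ler_normD _ _)); rewrite mulrDl; apply: lerD.
    rewrite distrC; apply: (le_trans (hCg _ _ bM b1 i j x jt)).
    by rewrite ler_pM2l //; exact: idist_mix_new_le.
  by apply: (le_trans (hS j x jt)); rewrite ler_pM2l //; exact: delta_le_idist.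
have gE j : grad A U1 i j = fun x => 1 * E j x + 1 * \sum_(a < t) U1 i a x * S a j.
  by apply/funext => x; rewrite /E; ring.
pose PE a j := if (i < s)%N then (dot (U1 i a) (E j) + dot (U1 i j) (E a)) / 2
  else (a == j)%:R * dot (U1 i j) (E j).
have hPE a j : (a < t)%N -> (j < t)%N -> `|PE a j| <= (n i)%:R * (1 * ((Cg + eps) * D)).
  move=> at_ jt.
  have hd a' j' : (a' < t)%N -> (j' < t)%N -> `|dot (U1 i a') (E j')| <= (n i)%:R * (1 * ((Cg + eps) * D)).
    by move=> h h'; apply: dot_bound => x; [exact: b1|exact: hE].
  move: hd; set B0 := (n i)%:R * _ => hd.
  rewrite /PE; case: ifP => _.
    have := hd _ _ at_ jt; have := hd _ _ jt at_.
    have := ler_normD (dot (U1 i a) (E j)) (dot (U1 i j) (E a)).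
    rewrite normrM (@ger0_norm _ 2^-1) //; lra.
  case: (a == j); first by rewrite mul1r; exact: hd.
  by rewrite mul0r normr0; apply: le_trans (hd _ _ jt jt).
(* [U1^T U1 S] is [S] for orthonormal columns; for unit columns the diagonals agree because [S] is
   diagonal. *)
have PS a j : (a < t)%N -> (j < t)%N -> multiplier A s U1 i a j = PE a j + S a j.
  move=> at_ jt.
  have US a' j' : (a' < t)%N -> dot (U1 i a') (fun x => \sum_(b < t) U1 i b x * S b j') =
      \sum_(b < t) S b j' * dot (U1 i b) (U1 i a').
    by move=> h; rewrite dotC (dot_suml t (U1 i) (S^~ j')).
  rewrite /multiplier /PE; have [i_s|si] := ltnP i s.
    have US' a' j' : (a' < t)%N -> dot (U1 i a') (fun x => \sum_(b < t) U1 i b x * S b j') = S a' j'.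
      move=> h; rewrite US // (bigD1 (Ordinal h)) //= big1 => [|b ba].
        by rewrite ((f1 i).1 i_s) // eqxx mulr1 addr0.
      by rewrite ((f1 i).1 i_s) // (_ : (b == a' :> nat) = false) ?mulr0 //; apply: negbTE.
    by rewrite !gE !dot_linr !US' // (symS j a) //; lra.
  case: (eqVneq a j) => [->|aj]; last by rewrite !mul0r add0r diagS.
  rewrite gE dot_linr US // (bigD1 (Ordinal jt)) //= big1 => [|b bj].
    by rewrite ((f1 i).2 si) // !mul1r mulr1 addr0.
  by rewrite diagS ?mul0r.
move=> j x jt; rewrite normrM ger0_norm // -mulrA ler_pM2l //.
have -> : residual A s t U1 i j x = E j x - \sum_(a < t) U1 i a x * PE a j.
  rewrite /residual /E -addrA -opprD; congr (_ - _); rewrite -big_split.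
  by apply: eq_bigr => a _; rewrite PS // mulrDr addrC.
apply: (le_trans (ler_normB _ _)); rewrite mulrDl; apply: lerD; first exact: hE.
apply: le_trans (@sum_bound t (fun a => U1 i a x * PE a j) (1 * ((n i)%:R * (1 * ((Cg + eps) * D)))) _) _.
  by move=> a at_; rewrite normrM ler_pM ?hPE ?b1.
by rewrite !mul1r !mulrA.
Qed.

Lemma sweep_residual : exists2 b, 0 < b & forall U1 U0,
  feasible n s t U1 -> feasible n s t U0 -> (forall i, block_update A s t eps c U1 U0 i) ->
  stationarity_gap A s t (encode t U1) <= (b * dist U1 U0) ^+ 2.
Proof.
have [i b b' bb h U1 U0 f1 f0 hu j x jt|i|b b0 hb] := @finite_uniform R 'I_k (fun i b => forall U1 U0,
  feasible n s t U1 -> feasible n s t U0 -> block_update A s t eps c U1 U0 i ->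
  forall j x, (j < t)%N -> `|2 * residual A s t U1 i j x| <= b * dist U1 U0).
- by apply: (le_trans (h U1 U0 f1 f0 hu j x jt)); rewrite ler_wpM2r ?idist_ge0.
- exact: block_residual.
exists (N.+1%:R * b) => [|U1 U0 f1 f0 hu]; first by rewrite mulr_gt0.
set D := dist U1 U0; have D0 : 0 <= D by exact: idist_ge0.
apply: (@le_trans _ _ (N%:R * (b * D) ^+ 2)); last first.
  have -> : (N.+1%:R * b * D) ^+ 2 = N.+1%:R ^+ 2 * (b * D) ^+ 2 by rewrite -exprMn mulrA.
  by rewrite ler_wpM2r ?sqr_ge0 // -natrX ler_nat; nia.
rewrite (_ : N%:R * _ = \sum_(m < N) (b * D) ^+ 2); last by rewrite sumr_const card_ord mulr_natl.
rewrite sum_entry; do 3!(apply: ler_sum => ? _).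
rewrite -real_normK ?num_real // ler_pXn2r ?nnegrE ?mulr_ge0 ?(ltW b0) //.
have resE l j x : (j < t)%N -> residual A s t (decode (encode t U1)) l j x = residual A s t U1 l j x.
  move=> jt; rewrite /residual grad_encodeK //; congr (_ - _).
  by apply: eq_bigr => a _; rewrite multiplier_encodeK // encodeK.
by rewrite resE // hb.
Qed.

(** Blocks gain in Euclidean displacement while the trajectory is measured in l1, and Cauchy-Schwarz
    costs the dimension [N]. The divisor [N.+1] stays nonzero when [t = 0]. *)
Lemma sweep_ascent U1 U0 : (forall i, block_update A s t eps c U1 U0 i) ->
  objective A t (encode t U0) + c / N.+1%:R * dist U1 U0 ^+ 2 <= objective A t (encode t U1).
Proof.
move=> hu; have fE U : objective A t (encode t U) = fobj n A t U.
  by apply: eq_bigr => j _; rewrite /lam colsof_encodeK.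
rewrite !fE -lerBrDl fobj_telescope.
have h : \sum_(i < k) c * (\sum_(j < t) dot (delta U1 U0 i j) (delta U1 U0 i j)) <=
    \sum_(i < k) (fobj n A t (mixn i.+1 U1 U0) - fobj n A t (mixn i U1 U0)).
  by apply: ler_sum => i _; exact: (hu i).2.
apply: le_trans h; rewrite -mulr_sumr -mulrA ler_pM2l // ler_pdivrMl //.
have := cauchy_schwarz (fun m : 'I_N => `|encode t U1 0 m - encode t U0 0 m|) (fun=> 1).
have -> : dot (fun m : 'I_N => `|encode t U1 0 m - encode t U0 0 m|) (fun=> 1) = dist U1 U0.
  by apply: eq_bigr => m _; rewrite mulr1.
have -> : dot (fun m : 'I_N => `|encode t U1 0 m - encode t U0 0 m|)
    (fun m : 'I_N => `|encode t U1 0 m - encode t U0 0 m|) =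
    \sum_(i < k) \sum_(j < t) dot (delta U1 U0 i j) (delta U1 U0 i j).
  rewrite /dot sum_entry; do 3!(apply: eq_bigr => ? _).
  by rewrite -normrM ger0_norm -?expr2 ?sqr_ge0 // !encodeE.
have -> : @dot R N (fun=> 1) (fun=> 1) = N%:R.
  transitivity (\sum_(m < N) (1 : R)); last by rewrite sumr_const card_ord.
  by apply: eq_bigr => m _; rewrite mulr1.
move=> h; apply: (le_trans h); rewrite mulrC ler_wpM2r ?ler_nat //.
by do 2!(apply: sumr_ge0 => ? _); exact: dot_ge0.
Qed.

Lemma residual_KKT U : feasible n s t U ->
  (forall l j x, (j < t)%N -> residual A s t U l j x = 0) -> KKT n A s t U.
Proof.
move=> feas res0; split=> //.
have gradE l (j : 'I_t) x : grad A U l j x = \sum_(a < t) U l a x * multiplier A s U l a j.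
  by apply/eqP; rewrite -subr_eq0; apply/eqP; exact: res0.
(* For unit columns the multiplier is [dot (U l j) (grad A U l j)], which equals [lam ^+ 2] whatever
   the block; hence one vector serves all modes from [s] on. *)
exists (fun l => \matrix_(a, j) multiplier A s U l a j), (fun j => lam n A U j ^+ 2) => l.
split=> [ls|sl]; first split.
- by apply/matrixP => a j; rewrite !mxE multiplier_sym.
- by move=> j x; rewrite -/(grad A U l j x) gradE; apply: eq_bigr => a _; rewrite mxE.
move=> j x; rewrite -/(grad A U l j x) gradE (bigD1 j) //= big1 => [|a aj].
  rewrite addr0 /multiplier ltnNge sl /= eqxx mul1r expr2; congr (_ * _).
  rewrite {2}/lam (tau_dot _ _ l) -dotZl dotC; apply: eq_bigr => b _.
  by rewrite /grad /colsof; ring.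
rewrite /multiplier ltnNge sl /= (_ : (a == j :> nat) = false) ?mul0r ?mulr0 //.
exact: negbTE.
Qed.

Theorem sweeps_converge (x : nat -> @iterate R k n) :
  (forall p, feasible n s t (x p)) ->
  (forall p i, block_update A s t eps c (x p.+1) (x p) i) ->
  exists U, (forall l j a, (j < t)%N -> x p l j a @[p --> \oo] --> U l j a) /\ KKT n A s t U.
Proof.
move=> feas hu.
have [C C0 slope] := objective_slope; have [b b0 hb] := sweep_residual.
have cube (v : 'rV[R]_N) : constraint_gap s t v = 0 -> in_cube 1 v.
  move=> /constraint_gapP/feasible_bounded bv; elim/entry_ind => l j a.
  by rewrite -decodeE bv.
have feasible_encode U : feasible n s t U -> constraint_gap s t (encode t U) = 0.
  move=> fU; apply/constraint_gapP => l; split=> [ls a j at_ jt|sl j jt]; rewrite !encodeK //.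
    exact: (fU l).1.
  exact: (fU l).2.
have [z [Hz Gz xz]] := @descent_converges R N 1 C (c / N.+1%:R) b (constraint_gap s t)
  (objective A t) (stationarity_gap A s t) (fun p => encode t (x p))
  (@polyf_constraint_gap R k n s t) (polyf_objective A t) (polyf_stationarity_gap A s t) cube
  (stationarity_gap_ge0 A s (t := t)) C0 (divr_gt0 c_gt0 (ltr0Sn _ N)) b0 slope
  (fun p => feasible_encode _ (feas p)) (fun p => sweep_ascent (hu p))
  (fun p => hb _ _ (feas p.+1) (feas p) (hu p)).
have fz : feasible n s t (decode z) by apply/constraint_gapP.
exists (decode z); split=> [l j a jt|].
  have := xz (enum_rank (mkentry (Ordinal jt) a)).
  by rewrite -decodeE; under eq_fun do rewrite encodeE.
apply: residual_KKT => // l j y jt; apply/eqP.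
have := residual_le_gap A s z (Ordinal jt) y; rewrite Gz sqrtr0 normr_le0 mulf_eq0.
by rewrite pnatr_eq0.
Qed.
End Convergence.

(** * Convergence of the algorithm *)

Lemma nonincreasing_nat_stabilizes (u : nat -> nat) : (forall p, u p.+1 <= u p)%N ->
  exists T, forall p, (T <= p)%N -> u p = u T.
Proof.
move=> hu; have mono p q : (p <= q)%N -> (u q <= u p)%N.
  by move=> /subnK <-; elim: (q - p)%N => // d IH; rewrite addSn (leq_trans (hu _)).
suff : forall m T0, (u T0 <= m)%N -> exists T, forall p, (T <= p)%N -> u p = u T.
  by move=> /(_ (u 0%N) 0%N (leqnn _)).
elim=> [|m IH] T0 hT0.
  by exists T0 => p /mono; move: hT0; rewrite leqn0 => /eqP ->; rewrite leqn0 => /eqP.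
have [[q Tq lt]|nlt] := pselect (exists2 q, (T0 <= q)%N & (u q < u T0)%N).
  by apply: (IH q); rewrite -ltnS (leq_trans lt).
exists T0 => p hp; apply/eqP; rewrite eqn_leq mono //= leqNgt; apply/negP => lt.
by apply: nlt; exists p.
Qed.

Unset Implicit Arguments.

Theorem theorem5p9 (R : realType) (k s : nat) (n : 'I_k -> nat) (r : nat)
  (A : @tensor R k n) (eps kappa : R) (Useq : nat -> @state R k n) :
  (3 <= k)%N -> (1 <= s <= k)%N ->
  (forall l : 'I_k, (0 < n l)%N) -> (0 < r)%N ->
  (forall l : 'I_k, (l < s)%N -> (r <= n l)%N) ->
  (exists idx, A idx != 0) ->
  0 < eps ->
  (Useq 0%N).1 = r -> feasible n s r (Useq 0%N).2 ->
  0 < fobj n A r (Useq 0%N).2 ->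
  0 < kappa -> kappa < Num.sqrt (fobj n A r (Useq 0%N).2 / r%:R) ->
  (forall p, iapd_step n A s eps kappa (Useq p) (Useq p.+1)) ->
  (* bounded *)
  (exists M : R, forall p (l : 'I_k) j (a : 'I_(n l)),
      (j < (Useq p).1)%N -> `|(Useq p).2 l j a| <= M) /\
  (* convergent, with eventually constant number of columns t, to a KKT point *)
  (exists (t T : nat) (Ustar : @iterate R k n),
      (forall p, (T <= p)%N -> (Useq p).1 = t) /\
      (forall (l : 'I_k) j (a : 'I_(n l)), (j < t)%N ->
          (fun p => (Useq p).2 l j a) @ \oo --> Ustar l j a) /\
      KKT n A s t Ustar).
Proof.
move=> _ /andP[s0 _] _ _ _ _ eps0 tr feas0 _ kappa0 _ steps.
have feas p : feasible n s (Useq p).1 (Useq p).2.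
  elim: p => [|p IH]; first by rewrite tr.
  by have [] := iapd_step_spec eps0 kappa0 s0 (steps p) IH.
split.
  by exists 1 => p l j a jt; exact: (feasible_bounded (feas p)).
have [|T hT] := @nonincreasing_nat_stabilizes (fun p => (Useq p).1).
  by move=> p; have [] := iapd_step_spec eps0 kappa0 s0 (steps p) (feas p).
have c0 : 0 < Num.min eps (kappa ^+ 2) by rewrite lt_min eps0 exprn_gt0.
have feasT p : feasible n s (Useq T).1 (Useq (p + T)%N).2.
  by rewrite -(hT (p + T)%N) ?leq_addl //; exact: feas.
have updT p i : block_update A s (Useq T).1 eps (Num.min eps (kappa ^+ 2))
    (Useq (p.+1 + T)%N).2 (Useq (p + T)%N).2 i.
  have [_ _ h] := iapd_step_spec eps0 kappa0 s0 (steps (p + T)%N) (feas _).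
  have tE : (Useq (p + T)%N).1 = (Useq T).1 by rewrite hT ?leq_addl.
  by rewrite -tE; apply: h; rewrite tE -addSn hT // leq_addl.
have [Ustar [cvU kkt]] := sweeps_converge eps0 c0 feasT updT.
exists (Useq T).1, T, Ustar; split=> //; split=> // l j a jt.
by rewrite -(cvg_shiftn T); exact: cvU.
Qed.
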